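(* Let $n\ge0$ be an integer, let $\mathscr{C}$ be an $n$-Frobenius category and let $M,N$ be objects of $\mathscr{C}$. Then for any integer $k\ge n$ and any syzygy sequence $\delta_N\in\mathrm{Ext}^k_{\mathscr{C}}(N,\Omega^kN)$ with respect to $n$-projectives, one has isomorphisms of abelian groups $$\mathrm{Ext}^k_{\mathscr{C}}(M,\Omega^kN)/\mathcal{P}\;\cong\;\mathrm{Nat}\big(\mathrm{Ext}^{k+1}_{\mathscr{C}}(N,-),\mathrm{Ext}^{k+1}_{\mathscr{C}}(M,-)\big)\;\cong\;\mathrm{Nat}\big(\mathrm{Ext}^{k+1}_{\mathscr{C}}(-,M),\mathrm{Ext}^{k+1}_{\mathscr{C}}(-,N)\big),$$ where $\mathcal{P}$ is the subgroup consisting of those extensions arising as a push-out along a morphism $f:P\to\Omega^kN$ with $P$ $n$-projective, i.e. those of the form $f\beta$ with $\beta\in\mathrm{Ext}^k_{\mathscr{C}}(M,P)$.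
   Context: $\mathscr{C}$ is an extension-closed full additive subcategory of an abelian category $\mathcal{A}$, regarded as an exact category whose conflations are the short exact sequences of $\mathcal{A}$ with all terms in $\mathscr{C}$. $\mathrm{Ext}^t_{\mathscr{C}}(B,A)$ denotes the Yoneda Ext group of this exact category (equivalence classes of extensions of length $t$, i.e. splices of $t$ conflations, starting at $A$ and ending at $B$, with Baer sum), with $\mathrm{Ext}^0_{\mathscr{C}}=\mathrm{Hom}_{\mathscr{C}}$; $f\beta$ denotes push-out of $\beta$ along $f$ (composition if the degree is $0$). An object $P$ (resp. $I$) of $\mathscr{C}$ is $n$-projective (resp. $n$-injective) if $\mathrm{Ext}^i_{\mathscr{C}}(P,X)=0$ (resp. $\mathrm{Ext}^i_{\mathscr{C}}(X,I)=0$) for all $i>n$ and all $X\in\mathscr{C}$. $\mathscr{C}$ is $n$-Frobenius if it has enough $n$-projectives (every object is the target of a deflation from an $n$-projective) and enough $n$-injectives (every object admits an inflation into an $n$-injective), and the classes of $n$-projective and $n$-injective objects coincide. A syzygy sequence $\delta_N\in\mathrm{Ext}^k_{\mathscr{C}}(N,\Omega^kN)$ with respect to $n$-projectives is an extension $\Omega^kN\to P_{k-1}\to\cdots\to P_0\to N$ of length $k$ with all $P_i$ $n$-projective; for $k=0$, $\Omega^0N=N$ and $\delta_N=1_N$. $\mathrm{Nat}(F,G)$ is the group of natural transformations between (covariant, resp. contravariant) functors from $\mathscr{C}$ to abelian groups. *)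

(* Defs.v *)
From HB Require Import structures.
From Stdlib Require Import Relations.
From mathcomp Require Import all_boot all_algebra.
From mathcomp Require Import boolp.

Set Implicit Arguments.
Unset Strict Implicit.
Unset Printing Implicit Defensive.

Import GRing.Theory.
Local Open Scope ring_scope.
Local Open Scope quotient_scope.

Reserved Notation "g \c f" (at level 40, left associativity).

Record preadditive := Preadditive {
  ob :> Type;
  hom : ob -> ob -> zmodType;
  idm : forall X, hom X X;
  comp : forall X Y Z, hom Y Z -> hom X Y -> hom X Z;
  compA : forall X Y Z W (h : hom Z W) (g : hom Y Z) (f : hom X Y),
    comp h (comp g f) = comp (comp h g) f;
  comp1m : forall X Y (f : hom X Y), comp (idm Y) f = f;
  compm1 : forall X Y (f : hom X Y), comp f (idm X) = f;
  compDm : forall X Y Z (g g' : hom Y Z) (f : hom X Y),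
    comp (g + g') f = comp g f + comp g' f;
  compmD : forall X Y Z (g : hom Y Z) (f f' : hom X Y),
    comp g (f + f') = comp g f + comp g f'
}.

Notation "g \c f" := (comp g f).
Arguments ob : simpl never.
Arguments hom {_} _ _ : simpl never.
Arguments idm {_} X : simpl never.
Arguments comp : simpl never.

Definition opcat (D : preadditive) : preadditive :=
  @Preadditive D (fun X Y => @hom D Y X) (fun X => idm X)
    (fun X Y Z g f => f \c g)
    (fun X Y Z W h g f => esym (compA f g h))
    (fun X Y f => compm1 f) (fun X Y f => comp1m f)
    (fun X Y Z g g' f => compmD f g g')
    (fun X Y Z g f f' => compDm f f' g).

Definition fullsub (D : preadditive) (S : D -> Prop) : preadditive :=
  @Preadditive {X : D | S X} (fun X Y => @hom D (sval X) (sval Y))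
    (fun X => idm (sval X))
    (fun X Y Z g f => g \c f)
    (fun X Y Z W h g f => compA h g f)
    (fun X Y f => comp1m f) (fun X Y f => compm1 f)
    (fun X Y Z g g' f => compDm g g' f)
    (fun X Y Z g f f' => compmD g f f').

Record biproduct (D : preadditive) (X Y : D) := Biproduct {
  bob :> D;
  in1 : hom X bob;
  in2 : hom Y bob;
  pr1 : hom bob X;
  pr2 : hom bob Y;
  pr1in1 : pr1 \c in1 = idm X;
  pr2in2 : pr2 \c in2 = idm Y;
  pr1in2 : pr1 \c in2 = 0;
  pr2in1 : pr2 \c in1 = 0;
  inprD : in1 \c pr1 + in2 \c pr2 = idm bob
}.
Arguments in1 {D X Y} b.
Arguments in2 {D X Y} b.
Arguments pr1 {D X Y} b.
Arguments pr2 {D X Y} b.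

(* In a preadditive category, Z is a zero object iff its identity is 0. *)
Definition is_zero (D : preadditive) (Z : D) : Prop := idm Z = 0.

Definition is_additive (D : preadditive) : Prop :=
  (exists Z : D, is_zero Z) /\ (forall X Y : D, inhabited (biproduct X Y)).

Definition is_kernel (D : preadditive) (K X Y : D) (f : hom X Y) (i : hom K X)
  : Prop :=
  f \c i = 0 /\
  forall (T : D) (t : hom T X), f \c t = 0 -> exists! s : hom T K, i \c s = t.

Definition is_cokernel (D : preadditive) (X Y Q : D) (f : hom X Y) (p : hom Y Q)
  : Prop :=
  p \c f = 0 /\
  forall (T : D) (t : hom Y T), t \c f = 0 -> exists! s : hom Q T, s \c p = t.

Definition is_mono (D : preadditive) (X Y : D) (f : hom X Y) : Prop :=
  forall (T : D) (s t : hom T X), f \c s = f \c t -> s = t.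

Definition is_epi (D : preadditive) (X Y : D) (f : hom X Y) : Prop :=
  forall (T : D) (s t : hom Y T), s \c f = t \c f -> s = t.

Definition short_exact (D : preadditive) (X E Y : D)
    (i : hom X E) (p : hom E Y) : Prop :=
  is_kernel p i /\ is_cokernel i p.

Record is_abelian (D : preadditive) : Prop := IsAbelian {
  abelian_additive : is_additive D;
  abelian_ker : forall (X Y : D) (f : hom X Y),
    exists (K : D) (i : hom K X), is_kernel f i;
  abelian_coker : forall (X Y : D) (f : hom X Y),
    exists (Q : D) (p : hom Y Q), is_cokernel f p;
  abelian_mono : forall (X Y : D) (f : hom X Y), is_mono f ->
    exists (Z : D) (g : hom Y Z), is_kernel g f;
  abelian_epi : forall (X Y : D) (f : hom X Y), is_epi f ->
    exists (Z : D) (g : hom Z X), is_cokernel g f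
}.

Record abelian := Abelian {
  abelian_cat :> preadditive;
  abelianP : is_abelian abelian_cat
}.

Record exact_sub (A : abelian) := ExactSub {
  mem_sub : A -> Prop;
  sub_additive : is_additive (fullsub mem_sub);
  sub_ext : forall (X E Y : A) (i : hom X E) (p : hom E Y),
    short_exact i p -> mem_sub X -> mem_sub Y -> mem_sub E
}.

Definition sub_cat (A : abelian) (C : exact_sub A) : preadditive :=
  fullsub (@mem_sub A C).
Coercion sub_cat : exact_sub >-> preadditive.

(* [conflation B X] is the type of conflations X -> mid -> B. *)
Record conflation (A : abelian) (C : exact_sub A) (B X : C) := Conflation {
  mid : C;
  infl : hom X mid;
  defl : hom mid B;
  conflP : @short_exact A (sval X) (sval mid) (sval B) infl defl
}.

Section Additive.
Variable D : preadditive.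
Implicit Types X Y Z W : D.

Lemma comp0m X Y Z (f : hom X Y) : (0 : hom Y Z) \c f = 0.
Proof. by apply: (addrI (0 \c f)); rewrite -compDm !addr0. Qed.

Lemma compm0 X Y Z (g : hom Y Z) : g \c (0 : hom X Y) = 0.
Proof. by apply: (addrI (g \c 0)); rewrite -compmD !addr0. Qed.

Lemma compNm X Y Z (g : hom Y Z) (f : hom X Y) : (- g) \c f = - (g \c f).
Proof. by apply/eqP; rewrite -addr_eq0 -compDm addNr comp0m. Qed.

Lemma compmN X Y Z (g : hom Y Z) (f : hom X Y) : g \c (- f) = - (g \c f).
Proof. by apply/eqP; rewrite -addr_eq0 -compmD addNr compm0. Qed.

Lemma pr1in1K X Y (b : biproduct X Y) W (f : hom W X) :
  pr1 b \c (in1 b \c f) = f.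
Proof. by rewrite compA pr1in1 comp1m. Qed.
Lemma pr2in2K X Y (b : biproduct X Y) W (f : hom W Y) :
  pr2 b \c (in2 b \c f) = f.
Proof. by rewrite compA pr2in2 comp1m. Qed.
Lemma pr1in2K X Y (b : biproduct X Y) W (f : hom W Y) :
  pr1 b \c (in2 b \c f) = 0.
Proof. by rewrite compA pr1in2 comp0m. Qed.
Lemma pr2in1K X Y (b : biproduct X Y) W (f : hom W X) :
  pr2 b \c (in1 b \c f) = 0.
Proof. by rewrite compA pr2in1 comp0m. Qed.

Definition bipE := (pr1in1, pr2in2, pr1in2, pr2in1, pr1in1K, pr2in2K,
  pr1in2K, pr2in1K, comp1m, compm1, comp0m, compm0, addr0, add0r).

Lemma bip_eqr X Y (b : biproduct X Y) W (f g : hom W b) :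
  pr1 b \c f = pr1 b \c g -> pr2 b \c f = pr2 b \c g -> f = g.
Proof.
move=> e1 e2; rewrite -[f]comp1m -[g]comp1m -(inprD b) !compDm -?compA.
by rewrite e1 e2.
Qed.

Lemma bip_eql X Y (b : biproduct X Y) W (f g : hom b W) :
  f \c in1 b = g \c in1 b -> f \c in2 b = g \c in2 b -> f = g.
Proof.
move=> e1 e2; rewrite -[f]compm1 -[g]compm1 -(inprD b) !compmD !compA.
by rewrite e1 e2.
Qed.

Definition diag X (b : biproduct X X) : hom X b := in1 b + in2 b.
Definition codiag X (b : biproduct X X) : hom b X := pr1 b + pr2 b.

Definition bmap X Y (b : biproduct X Y) X' Y' (b' : biproduct X' Y')
    (f : hom X X') (g : hom Y Y') : hom b b' :=
  in1 b' \c (f \c pr1 b) + in2 b' \c (g \c pr2 b).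

Lemma bmap1 X Y (b : biproduct X Y) : bmap b b (idm X) (idm Y) = idm b.
Proof. by rewrite /bmap !comp1m inprD. Qed.

Lemma is_kernel_mono K X Y (f : hom X Y) (i : hom K X) :
  is_kernel f i -> is_mono i.
Proof.
case=> fi0 ker T s t e.
have [|u [_ hu]] := ker T (i \c t); first by rewrite compA fi0 comp0m.
by rewrite -(hu s e) -(hu t).
Qed.

Lemma is_kernel_bmap X1 X2 Y1 Y2 Z1 Z2 (bX : biproduct X1 X2)
    (bY : biproduct Y1 Y2) (bZ : biproduct Z1 Z2)
    (i1 : hom X1 Y1) (i2 : hom X2 Y2) (p1 : hom Y1 Z1) (p2 : hom Y2 Z2) :
  is_kernel p1 i1 -> is_kernel p2 i2 ->
  is_kernel (bmap bY bZ p1 p2) (bmap bX bY i1 i2).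
Proof.
move=> k1 k2; have m1 := is_kernel_mono k1; have m2 := is_kernel_mono k2.
case: k1 k2 => z1 u1 [z2 u2]; split.
  rewrite /bmap !(compDm, compmD) -?compA !bipE.
  by rewrite !(compA p1) !(compA p2) z1 z2 !bipE.
move=> T t e.
have e1 : p1 \c (pr1 bY \c t) = 0.
  have := congr1 (fun g => pr1 bZ \c g) e.
  by rewrite /bmap !(compDm, compmD) -?compA !bipE.
have e2 : p2 \c (pr2 bY \c t) = 0.
  have := congr1 (fun g => pr2 bZ \c g) e.
  by rewrite /bmap !(compDm, compmD) -?compA !bipE.
have [s1 [h1 _]] := u1 _ _ e1; have [s2 [h2 _]] := u2 _ _ e2.
exists (in1 bX \c s1 + in2 bX \c s2); split.
  apply: (bip_eqr (b := bY)).
    by rewrite /bmap !(compDm, compmD) -?compA !bipE.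
  by rewrite /bmap !(compDm, compmD) -?compA !bipE.
move=> s hs; apply: (bip_eqr (b := bX)).
  rewrite !(compDm, compmD) -?compA !bipE; apply: m1.
  by rewrite h1 -hs /bmap !(compDm, compmD) -?compA !bipE.
rewrite !(compDm, compmD) -?compA !bipE; apply: m2.
by rewrite h2 -hs /bmap !(compDm, compmD) -?compA !bipE.
Qed.

Lemma is_kernel_in1 X Y (b : biproduct X Y) : is_kernel (pr2 b) (in1 b).
Proof.
split; first exact: pr2in1.
move=> T t e; exists (pr1 b \c t); split.
  by apply: (bip_eqr (b := b)); rewrite !bipE.
by move=> s <-; rewrite !bipE.
Qed.

(* The square  j \c f = h \c i  is a push-out of i and f. *)
Definition is_pushout X E X' E' (i : hom X E) (f : hom X X')
    (h : hom E E') (j : hom X' E') : Prop :=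
  h \c i = j \c f /\
  forall (T : D) (u : hom E T) (v : hom X' T), u \c i = v \c f ->
    exists! w : hom E' T, w \c h = u /\ w \c j = v.

End Additive.

(* The square  p \c h = g \c q  is a pull-back of p and g. *)
Definition is_pullback (D : preadditive) (E Y Y' E' : D) (p : hom E Y)
    (g : hom Y' Y) (h : hom E' E) (q : hom E' Y') : Prop :=
  p \c h = g \c q /\
  forall (T : D) (u : hom T E) (v : hom T Y'), p \c u = g \c v ->
    exists! w : hom T E', h \c w = u /\ q \c w = v.

Definition opbip (D : preadditive) (X Y : D) (b : biproduct X Y) :
    @biproduct (opcat D) X Y :=
  @Biproduct (opcat D) X Y b (pr1 b) (pr2 b) (in1 b) (in2 b)
    (pr1in1 b) (pr2in2 b) (pr2in1 b) (pr1in2 b) (inprD b).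

Lemma bmap_op (D : preadditive) (X Y X' Y' : D) (b : biproduct X Y)
    (b' : biproduct X' Y') (f : hom X X') (g : hom Y Y') :
  @bmap (opcat D) _ _ (opbip b') _ _ (opbip b) f g = bmap b b' f g.
Proof.
transitivity ((in1 b' \c f) \c pr1 b + (in2 b' \c g) \c pr2 b); first by [].
by rewrite -!compA.
Qed.

Lemma is_cokernel_bmap (D : preadditive) (X1 X2 Y1 Y2 Z1 Z2 : D)
    (bX : biproduct X1 X2) (bY : biproduct Y1 Y2) (bZ : biproduct Z1 Z2)
    (i1 : hom X1 Y1) (i2 : hom X2 Y2) (p1 : hom Y1 Z1) (p2 : hom Y2 Z2) :
  is_cokernel i1 p1 -> is_cokernel i2 p2 ->
  is_cokernel (bmap bX bY i1 i2) (bmap bY bZ p1 p2).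
Proof.
move=> k1 k2.
have := @is_kernel_bmap (opcat D) _ _ _ _ _ _ (opbip bZ) (opbip bY) (opbip bX)
  p1 p2 i1 i2 k1 k2.
by rewrite !bmap_op.
Qed.

Lemma is_cokernel_pr2 (D : preadditive) (X Y : D) (b : biproduct X Y) :
  is_cokernel (in1 b) (pr2 b).
Proof.
split; first exact: pr2in1.
move=> T t e; exists (t \c in2 b); split.
  by apply: (bip_eql (b := b)); rewrite -?compA !bipE.
by move=> s <-; rewrite -?compA !bipE.
Qed.

Lemma is_additive_op (D : preadditive) : is_additive D -> is_additive (opcat D).
Proof.
case=> z b; split; first exact: z.
by move=> X Y; case: (b X Y) => b0; split; exact: opbip.
Qed.

Lemma is_abelian_op (D : preadditive) : is_abelian D -> is_abelian (opcat D).
Proof.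
case=> a k c m e; split.
- exact: is_additive_op.
- by move=> X Y f; exact: c.
- by move=> X Y f; exact: k.
- by move=> X Y f; exact: e.
- by move=> X Y f; exact: m.
Qed.

Lemma ses_pushout (D : preadditive) (hD : is_abelian D) (X E Y X' : D)
    (i : hom X E) (p : hom E Y) (f : hom X X') :
  short_exact i p ->
  exists (E' : D) (j : hom X' E') (r : hom E' Y) (h : hom E E'),
    [/\ short_exact j r, is_pushout i f h j & r \c h = p].
Proof.
case=> ki cp; have mi := is_kernel_mono ki; case: ki => pi0 ki.
case: cp => _ cp.
have ep : is_epi p.
  move=> T s t e; have [|u [_ hu]] := cp T (t \c p).
    by rewrite -compA pi0 compm0.
  by rewrite -(hu s e) -(hu t).
case: hD => [[_ bD]] _ cD mD _.
case: (bD E X') => S.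
pose m := in1 S \c i - in2 S \c f.
have pr1m : pr1 S \c m = i by rewrite /m compmD compmN !bipE oppr0 addr0.
have mm : is_mono m.
  move=> T s t e; apply: mi; rewrite -pr1m -?compA.
  by rewrite e.
have [E' [q [qm0 cq]]] := cD _ _ m.
have eq : is_epi q.
  move=> T s t e; have [|u [_ hu]] := cq T (t \c q).
    by rewrite -compA qm0 compm0.
  by rewrite -(hu s e) -(hu t).
have hqm : q \c in1 S \c i = q \c in2 S \c f.
  by apply/eqP; rewrite -subr_eq0 -?compA -compmN -compmD; apply/eqP.
have [|r [hr _]] := cq _ (p \c pr1 S); first by rewrite -compA pr1m.
have rj0 : r \c (q \c in2 S) = 0 by rewrite compA hr -compA !bipE.
have rh : r \c (q \c in1 S) = p by rewrite compA hr -compA !bipE.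
have km : is_kernel q m.
  have [Z [g [gm0 kg]]] := mD _ _ m mm.
  split=> // T t e; have [|g' [hg' _]] := cq _ g; first by [].
  by apply: kg; rewrite -hg' -compA e compm0.
have mj : is_mono (q \c in2 S).
  move=> T s t e.
  have e0 : q \c (in2 S \c (s - t)) = 0.
    by rewrite compA compmD compmN e subrr.
  case: km => _ /(_ _ _ e0) [w [hw _]].
  have w0 : w = 0.
    by apply: mi; rewrite -pr1m -?compA hw !bipE.
  apply/eqP; rewrite -subr_eq0; apply/eqP.
  by rewrite -[s - t](pr2in2K S) -hw w0 !bipE.
have cr : is_cokernel (q \c in2 S) r.
  split=> // T t e.
  have [|u [hu _]] := cp _ (t \c (q \c in1 S)).
    by rewrite -compA hqm compA e comp0m.
  exists u; split.
    apply: eq; rewrite -compA hr; apply: (bip_eql (b := S)).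
      by rewrite -?compA !bipE hu !compA.
    by rewrite -?compA !bipE.
  move=> u' hu'; apply: ep.
  by rewrite hu -hu' -?compA; congr (_ \c _); rewrite rh.
exists E', (q \c in2 S), r, (q \c in1 S); split=> //.
  split=> //; have [Z [g [gj0 kg]]] := mD _ _ _ mj.
  split=> // T t e; apply: kg.
  case: cr => _ /(_ _ _ gj0) [g' [<- _]].
  by rewrite -compA e compm0.
split=> // T u v e.
have [|w [hw hu]] := cq _ (u \c pr1 S + v \c pr2 S).
  rewrite compDm -?compA pr1m /m compmD compmN !bipE compmN e.
  by rewrite subrr.
exists w; split.
  by rewrite !compA hw !compDm -?compA !bipE.
move=> w' [h1 h2]; apply: hu; apply: (bip_eql (b := S)).
  by rewrite compDm -?compA !bipE.
by rewrite compDm -?compA !bipE.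
Qed.

Lemma ses_pullback (D : preadditive) (hD : is_abelian D) (X E Y Y' : D)
    (i : hom X E) (p : hom E Y) (g : hom Y' Y) :
  short_exact i p ->
  exists (E' : D) (j : hom X E') (r : hom E' Y') (h : hom E' E),
    [/\ short_exact j r, is_pullback p g h r & h \c j = i].
Proof.
case=> k c.
have [E' [j [r [h [[? ?] ? ?]]]]] :=
  @ses_pushout (opcat D) (is_abelian_op hD) _ _ _ Y' p i g (conj c k).
by exists E', r, j, h; split.
Qed.

Section Conflations.
Variables (A : abelian) (C : exact_sub A).
Implicit Types X Y B K : C.

Definition conf_mor B X B' X' (E : conflation B X) (E' : conflation B' X')
    (f : hom X X') (g : hom B B') : Prop :=
  exists h : hom (mid E) (mid E'),
    h \c infl E = infl E' \c f /\ defl E' \c h = g \c defl E.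

Lemma conf_mor_comp B X B' X' B'' X'' (E : conflation B X)
    (E' : conflation B' X') (E'' : conflation B'' X'') f g f' g' :
  conf_mor E E' f g -> conf_mor E' E'' f' g' ->
  conf_mor E E'' (f' \c f) (g' \c g).
Proof.
move=> [h [h1 h2]] [h' [h1' h2']]; exists (h' \c h); split.
  by rewrite -compA h1 compA h1' -compA.
by rewrite compA h2' -compA h2 compA.
Qed.

Lemma conf_mor_id B X (E : conflation B X) : conf_mor E E (idm X) (idm B).
Proof. by exists (idm (mid E)); rewrite !comp1m !compm1. Qed.

Lemma conf_push_ex B X X' (f : hom X X') (E : conflation B X) :
  exists E' : conflation B X', exists h : hom (mid E) (mid E'),
    @is_pushout A _ _ _ _ (infl E) f h (infl E') /\ defl E' \c h = defl E.
Proof.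
have [E' [j [r [h [s po e]]]]] := ses_pushout (abelianP A) f (conflP E).
have mE : mem_sub C E'.
  exact: (sub_ext s (svalP X') (svalP B)).
exists (@Conflation A C B X' (exist _ E' mE) j r s).
by exists h.
Qed.

Lemma conf_pull_ex B B' X (g : hom B' B) (E : conflation B X) :
  exists E' : conflation B' X, exists h : hom (mid E') (mid E),
    @is_pullback A _ _ _ _ (defl E) g h (defl E') /\ h \c infl E' = infl E.
Proof.
have [E' [j [r [h [s pb e]]]]] := ses_pullback (abelianP A) g (conflP E).
have mE : mem_sub C E'.
  exact: (sub_ext s (svalP X) (svalP B')).
exists (@Conflation A C B' X (exist _ E' mE) j r s).
by exists h.
Qed.

Definition conf_push B X X' (f : hom X X') (E : conflation B X) :
  conflation B X' := projT1 (cid (conf_push_ex f E)).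
Definition conf_pull B B' X (g : hom B' B) (E : conflation B X) :
  conflation B' X := projT1 (cid (conf_pull_ex g E)).

Lemma conf_push_mor B X X' (f : hom X X') (E : conflation B X) :
  conf_mor E (conf_push f E) f (idm B).
Proof.
rewrite /conf_push; case: cid => E' /= [h [[e _] e']].
by exists h; rewrite comp1m.
Qed.

Lemma conf_pull_mor B B' X (g : hom B' B) (E : conflation B X) :
  conf_mor (conf_pull g E) E (idm X) g.
Proof.
rewrite /conf_pull; case: cid => E' /= [h [[e _] e']].
by exists h; rewrite compm1.
Qed.

Lemma defl_infl B X (E : conflation B X) : defl E \c infl E = 0.
Proof. by have [[z _] _] := conflP E. Qed.

Lemma conf_push_univ B X X' B' (E : conflation B X) (E' : conflation B' X')
    (f : hom X X') (g : hom B B') :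
  conf_mor E E' f g -> conf_mor (conf_push f E) E' (idm X') g.
Proof.
rewrite /conf_push; case: cid => F /= [h [[e po0] e']] [u [u1 u2]].
have po (T : C) (a : hom (mid E) T) (b : hom X' T) : a \c infl E = b \c f ->
  exists! w : hom (mid F) T, w \c h = a /\ w \c infl F = b := po0 (sval T) a b.
have [w [[w1 w2] _]] := po _ _ _ u1.
exists w; split; first by rewrite compm1.
have uniq (t t' : hom (mid F) B') :
  t \c h = t' \c h -> t \c infl F = t' \c infl F -> t = t'.
  move=> c1 c2.
  have [|x [_ hx]] := po B' (t \c h) (t \c infl F).
    by have := congr1 (fun z => t \c z) e; rewrite /= !compA.
  by rewrite -(hx t) // -(hx t') //; split; rewrite -?c1 -?c2.
apply: uniq; first by rewrite -!compA w1 u2 e'.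
by rewrite -!compA w2 !defl_infl compm0.
Qed.

Lemma conf_pull_univ B X X' B' (E : conflation B X) (E' : conflation B' X')
    (f : hom X X') (g : hom B B') :
  conf_mor E E' f g -> conf_mor E (conf_pull g E') f (idm B).
Proof.
rewrite /conf_pull; case: cid => F /= [h [[e pb0] e']] [u [u1 u2]].
have pb (T : C) (a : hom T (mid E')) (b : hom T B) : defl E' \c a = g \c b ->
  exists! w : hom T (mid F), h \c w = a /\ defl F \c w = b := pb0 (sval T) a b.
have [w [[w1 w2] _]] := pb _ _ _ u2.
exists w; split; last by rewrite comp1m.
have uniq (t t' : hom X (mid F)) :
  h \c t = h \c t' -> defl F \c t = defl F \c t' -> t = t'.
  move=> c1 c2.
  have [|x [_ hx]] := pb X (h \c t) (defl F \c t).
    by have := congr1 (fun z => z \c t) e; rewrite /= -!compA.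
  by rewrite -(hx t) // -(hx t') //; split; rewrite -?c1 -?c2.
apply: uniq; first by rewrite !compA w1 u1 e'.
by rewrite !compA w2 !defl_infl comp0m.
Qed.

Lemma bip_ex X Y : inhabited (biproduct X Y).
Proof. by case: (sub_additive C). Qed.

Definition bip X Y : biproduct X Y :=
  projT1 (cid (let: inhabits b := bip_ex X Y in ex_intro (fun=> True) b I)).

Lemma zob_ex : exists Z : C, is_zero Z.
Proof. by case: (sub_additive C). Qed.

Definition zob : C := projT1 (cid zob_ex).

Lemma zobP : is_zero zob. Proof. exact: (projT2 (cid zob_ex)). Qed.

Definition bip_sub X Y (b : biproduct X Y) : biproduct (sval X) (sval Y) :=
  @Biproduct A (sval X) (sval Y) (sval (bob b)) (in1 b) (in2 b) (pr1 b) (pr2 b)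
    (pr1in1 b) (pr2in2 b) (pr1in2 b) (pr2in1 b) (inprD b).

Definition bipmap X Y X' Y' (f : hom X X') (g : hom Y Y') :
  hom (bip X Y) (bip X' Y') := bmap (bip X Y) (bip X' Y') f g.

Lemma conf_sum_ses B X B' X' (E : conflation B X) (E' : conflation B' X') :
  @short_exact A _ _ _ (bipmap (infl E) (infl E')) (bipmap (defl E) (defl E')).
Proof.
have [k c] := conflP E; have [k' c'] := conflP E'; split.
  exact: (is_kernel_bmap (bip_sub (bip X X')) (bip_sub (bip (mid E) (mid E')))
    (bip_sub (bip B B')) k k').
exact: (is_cokernel_bmap (bip_sub (bip X X')) (bip_sub (bip (mid E) (mid E')))
    (bip_sub (bip B B')) c c').
Qed.

Definition conf_sum B X B' X' (E : conflation B X) (E' : conflation B' X') :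
    conflation (bip B B') (bip X X') :=
  Conflation (conf_sum_ses E E').

Lemma conf_split_ses B X :
  @short_exact A _ _ _ (in1 (bip X B)) (pr2 (bip X B)).
Proof.
split; first exact: (is_kernel_in1 (bip_sub (bip X B))).
exact: (is_cokernel_pr2 (bip_sub (bip X B))).
Qed.

Definition conf_split B X : conflation B X := Conflation (conf_split_ses B X).

End Conflations.

Section Extensions.
Variables (A : abelian) (C : exact_sub A).
Implicit Types X Y B K : C.

(* An element of [yseq t B X] is an extension of length t.+1 starting at X and
   ending at B, given as a list of conflations
     X -> mid -> K_1,  K_1 -> mid -> K_2,  ...,  K_t -> mid -> B. *)
Fixpoint yseq (t : nat) (B X : C) : Type :=
  if t is t'.+1 then {K : C & (conflation K X * yseq t' B K)%type}
  else conflation B X.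

Definition ysplice t B K X (E : conflation K X) (R : yseq t B K) :
  yseq t.+1 B X := existT _ K (E, R).

Fixpoint yseq_mor (t : nat) : forall B X B' X' (E : yseq t B X)
    (E' : yseq t B' X') (f : hom X X') (g : hom B B'), Prop :=
  if t is t'.+1 then fun B X B' X' E E' f g =>
    exists k : hom (projT1 E) (projT1 E'),
      conf_mor (projT2 E).1 (projT2 E').1 f k /\
      yseq_mor (projT2 E).2 (projT2 E').2 k g
  else fun B X B' X' E E' f g => conf_mor E E' f g.

Fixpoint yseq_push (t : nat) : forall B X X' (f : hom X X') (E : yseq t B X),
    yseq t B X' :=
  if t is t'.+1 then fun B X X' f E =>
    ysplice (conf_push f (projT2 E).1) (projT2 E).2
  else fun B X X' f E => conf_push f E.

Fixpoint yseq_pull (t : nat) : forall B B' X (g : hom B' B) (E : yseq t B X),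
    yseq t B' X :=
  if t is t'.+1 then fun B B' X g E =>
    ysplice (projT2 E).1 (yseq_pull g (projT2 E).2)
  else fun B B' X g E => conf_pull g E.

Fixpoint yseq_sum (t : nat) : forall B X B' X' (E : yseq t B X)
    (E' : yseq t B' X'), yseq t (bip B B') (bip X X') :=
  if t is t'.+1 then fun B X B' X' E E' =>
    ysplice (conf_sum (projT2 E).1 (projT2 E').1)
            (yseq_sum (projT2 E).2 (projT2 E').2)
  else fun B X B' X' E E' => conf_sum E E'.

(* X -> X (+) B -> B in length 1; in greater length the successive cokernels
   K_i are the zero object, and the middle terms are X (+) 0, 0, ..., 0 (+) B. *)
Fixpoint yseq_split (t : nat) : forall B X, yseq t B X :=
  if t is t'.+1 then fun B X =>
    ysplice (conf_split (zob C) X) (yseq_split t' B (zob C))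
  else fun B X => conf_split B X.

Fixpoint yseq_mids (Q : C -> Prop) (t : nat) :
    forall B X (E : yseq t B X), Prop :=
  if t is t'.+1 then fun B X E =>
    Q (mid (projT2 E).1) /\ yseq_mids Q (projT2 E).2
  else fun B X E => Q (mid E).

Lemma yseq_mor_comp t : forall B X B' X' B'' X'' (E : yseq t B X)
    (E' : yseq t B' X') (E'' : yseq t B'' X'') f g f' g',
  yseq_mor E E' f g -> yseq_mor E' E'' f' g' ->
  yseq_mor E E'' (f' \c f) (g' \c g).
Proof.
elim: t => [|t IH] B X B' X' B'' X'' E E' E'' f g f' g'.
  exact: conf_mor_comp.
case=> k [h1 h2] [k' [h1' h2']]; exists (k' \c k); split.
  exact: conf_mor_comp h1 h1'.
exact: IH h2 h2'.
Qed.

Lemma yseq_mor_id t : forall B X (E : yseq t B X),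
  yseq_mor E E (idm X) (idm B).
Proof.
elim: t => [|t IH] B X E; first exact: conf_mor_id.
by exists (idm _); split; [exact: conf_mor_id | exact: IH].
Qed.

Lemma yseq_push_mor t : forall B X X' (f : hom X X') (E : yseq t B X),
  yseq_mor E (yseq_push f E) f (idm B).
Proof.
case: t => [|t] B X X' f E; first exact: conf_push_mor.
by exists (idm _); split; [exact: conf_push_mor | exact: yseq_mor_id].
Qed.

Lemma yseq_pull_mor t : forall B B' X (g : hom B' B) (E : yseq t B X),
  yseq_mor (yseq_pull g E) E (idm X) g.
Proof.
elim: t => [|t IH] B B' X g E; first exact: conf_pull_mor.
by exists (idm _); split; [exact: conf_mor_id | exact: IH].
Qed.

Lemma yseq_push_univ t : forall B X X' B' (E : yseq t B X) (E' : yseq t B' X')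
    (f : hom X X') (g : hom B B'),
  yseq_mor E E' f g -> yseq_mor (yseq_push f E) E' (idm X') g.
Proof.
case: t => [|t] B X X' B' E E' f g; first exact: conf_push_univ.
by case=> k [h1 h2]; exists k; split; [exact: conf_push_univ |].
Qed.

Lemma yseq_pull_univ t : forall B X X' B' (E : yseq t B X) (E' : yseq t B' X')
    (f : hom X X') (g : hom B B'),
  yseq_mor E E' f g -> yseq_mor E (yseq_pull g E') f (idm B).
Proof.
elim: t => [|t IH] B X X' B' E E' f g; first exact: conf_pull_univ.
by case=> k [h1 h2]; exists k; split; [|exact: IH].
Qed.

Lemma yseq_sum_mor t : forall B1 X1 B2 X2 B1' X1' B2' X2'
    (E1 : yseq t B1 X1) (E2 : yseq t B2 X2)
    (E1' : yseq t B1' X1') (E2' : yseq t B2' X2') f1 f2 g1 g2,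
  yseq_mor E1 E1' f1 g1 -> yseq_mor E2 E2' f2 g2 ->
  yseq_mor (yseq_sum E1 E2) (yseq_sum E1' E2') (bipmap f1 f2) (bipmap g1 g2).
Proof.
have base B1 X1 B2 X2 B1' X1' B2' X2'
    (E1 : conflation B1 X1) (E2 : conflation B2 X2)
    (E1' : conflation B1' X1') (E2' : conflation B2' X2') f1 f2 g1 g2 :
  conf_mor E1 E1' f1 g1 -> conf_mor E2 E2' f2 g2 ->
  conf_mor (conf_sum E1 E2) (conf_sum E1' E2') (bipmap f1 f2) (bipmap g1 g2).
  move=> [h1 [a1 b1]] [h2 [a2 b2]]; exists (bipmap h1 h2); split.
    rewrite /= /bipmap /bmap !(compDm, compmD) -?compA !bipE.
    by rewrite !(compA h1) !(compA h2) a1 a2 -?compA.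
  rewrite /= /bipmap /bmap !(compDm, compmD) -?compA !bipE.
  by rewrite !(compA _ h1) !(compA _ h2) b1 b2 -?compA.
elim: t => [|t IH] B1 X1 B2 X2 B1' X1' B2' X2' E1 E2 E1' E2' f1 f2 g1 g2.
  exact: base.
case=> k1 [h1 r1] [k2 [h2 r2]]; exists (bipmap k1 k2); split.
  exact: base.
exact: IH.
Qed.

Lemma yseq_diag_mor t : forall B X (E : yseq t B X),
  yseq_mor E (yseq_sum E E) (diag (bip X X)) (diag (bip B B)).
Proof.
have base B X (E : conflation B X) :
  conf_mor E (conf_sum E E) (diag (bip X X)) (diag (bip B B)).
  exists (diag (bip _ _)).
  by split; rewrite /= /bipmap /bmap /diag !(compDm, compmD) -?compA !bipE.
elim: t => [|t IH] B X E; first exact: base.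
by exists (diag (bip _ _)); split; [exact: base | exact: IH].
Qed.

Lemma yseq_codiag_mor t : forall B X (E : yseq t B X),
  yseq_mor (yseq_sum E E) E (codiag (bip X X)) (codiag (bip B B)).
Proof.
have base B X (E : conflation B X) :
  conf_mor (conf_sum E E) E (codiag (bip X X)) (codiag (bip B B)).
  exists (codiag (bip _ _)).
  by split; rewrite /= /bipmap /bmap /codiag !(compDm, compmD) -?compA !bipE.
elim: t => [|t IH] B X E; first exact: base.
by exists (codiag (bip _ _)); split; [exact: base | exact: IH].
Qed.

Definition bipswap X Y : hom (bip X Y) (bip Y X) :=
  in1 (bip Y X) \c pr2 (bip X Y) + in2 (bip Y X) \c pr1 (bip X Y).

Lemma yseq_swap_mor t : forall B X B' X' (E : yseq t B X) (E' : yseq t B' X'),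
  yseq_mor (yseq_sum E E') (yseq_sum E' E) (bipswap X X') (bipswap B B').
Proof.
have base B X B' X' (E : conflation B X) (E' : conflation B' X') :
  conf_mor (conf_sum E E') (conf_sum E' E) (bipswap X X') (bipswap B B').
  exists (bipswap _ _).
  by split; rewrite /= /bipmap /bmap /bipswap !(compDm, compmD) -?compA !bipE
    addrC.
elim: t => [|t IH] B X B' X' E E'; first exact: base.
by exists (bipswap _ _); split; [exact: base | exact: IH].
Qed.

Definition bipassoc X Y W : hom (bip (bip X Y) W) (bip X (bip Y W)) :=
  in1 (bip X (bip Y W)) \c (pr1 (bip X Y) \c pr1 (bip (bip X Y) W)) +
  in2 (bip X (bip Y W)) \c
    (in1 (bip Y W) \c (pr2 (bip X Y) \c pr1 (bip (bip X Y) W)) +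
     in2 (bip Y W) \c pr2 (bip (bip X Y) W)).

Lemma yseq_assoc_mor t : forall B X B' X' B'' X'' (E : yseq t B X)
    (E' : yseq t B' X') (E'' : yseq t B'' X''),
  yseq_mor (yseq_sum (yseq_sum E E') E'') (yseq_sum E (yseq_sum E' E''))
    (bipassoc X X' X'') (bipassoc B B' B'').
Proof.
have base B X B' X' B'' X'' (E : conflation B X) (E' : conflation B' X')
    (E'' : conflation B'' X'') :
  conf_mor (conf_sum (conf_sum E E') E'') (conf_sum E (conf_sum E' E''))
    (bipassoc X X' X'') (bipassoc B B' B'').
  exists (bipassoc _ _ _).
  by split; rewrite /= /bipmap /bmap /bipassoc !(compDm, compmD) -?compA !bipE.
elim: t => [|t IH] B X B' X' B'' X'' E E' E''; first exact: base.
by exists (bipassoc _ _ _); split; [exact: base | exact: IH].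
Qed.

Lemma yseq_split_mor t : forall B X X' (E : yseq t B X),
  yseq_mor E (yseq_split t B X') (0 : hom X X') (idm B).
Proof.
have base B X B' X' (E : conflation B X) (g : hom B B') :
  conf_mor E (conf_split B' X') (0 : hom X X') g.
  exists (in2 (bip X' B') \c (g \c defl E)); rewrite /= -?compA !bipE.
  by rewrite defl_infl !bipE.
elim: t => [|t IH] B X X' E; first exact: base.
by exists 0; split; [exact: base | exact: IH].
Qed.

End Extensions.

HB.instance Definition _ (A : abelian) (C : exact_sub A) t (B X : C) :=
  gen_eqMixin (yseq t B X).
HB.instance Definition _ (A : abelian) (C : exact_sub A) t (B X : C) :=
  gen_choiceMixin (yseq t B X).

Section Yoneda.
Variables (A : abelian) (C : exact_sub A).
Implicit Types X Y B K : C.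

(* The equivalence relation generated by morphisms with identity ends, which is
   the Yoneda equivalence of extensions. *)
Definition yseq_equiv t B X : relation (yseq t B X) :=
  clos_refl_sym_trans _ (fun E E' => yseq_mor E E' (idm X) (idm B)).

Definition yseq_equivb t B X (E E' : yseq t B X) : bool := `[< yseq_equiv E E' >].

Lemma yseq_equivb_equiv t B X : equiv_class_of (@yseq_equivb t B X).
Proof.
split=> [E|E E'|E' E E''].
- by apply/asboolP; exact: rst_refl.
- by apply/asboolP/asboolP => h; exact: rst_sym.
- by move=> /asboolP h /asboolP h'; apply/asboolP; exact: rst_trans h h'.
Qed.

Canonical yseq_equiv_rel t B X := EquivRelPack (@yseq_equivb_equiv t B X).

Definition yext t B X := {eq_quot (@yseq_equivb t B X)}.

HB.instance Definition _ t B X := Choice.on (yext t B X).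
HB.instance Definition _ t B X := EqQuotient.on (yext t B X).

Definition ycls t B X (E : yseq t B X) : yext t B X := \pi_(yext t B X) E.

Definition ypush t B X X' (f : hom X X') (x : yext t B X) : yext t B X' :=
  ycls (yseq_push f (repr x)).

Definition ypull t B B' X (g : hom B' B) (x : yext t B X) : yext t B' X :=
  ycls (yseq_pull g (repr x)).

Definition ysum t B X B' X' (x : yext t B X) (x' : yext t B' X') :
  yext t (bip B B') (bip X X') := ycls (yseq_sum (repr x) (repr x')).

(* Baer sum: push out the direct sum of extensions along the codiagonal of X
   and pull it back along the diagonal of B. *)
Definition yadd t B X (x y : yext t B X) : yext t B X :=
  ypush (codiag (bip X X)) (ypull (diag (bip B B)) (ysum x y)).

Definition yzero t B X : yext t B X := ycls (yseq_split t B X).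

Definition yopp t B X (x : yext t B X) : yext t B X := ypush (- idm X) x.

Lemma ycls_ind t B X (P : yext t B X -> Prop) :
  (forall E, P (ycls E)) -> forall x, P x.
Proof. by move=> h x; rewrite -[x]reprK; exact: h. Qed.

Lemma ycls_eqP t B X (E E' : yseq t B X) :
  ycls E = ycls E' <-> yseq_equiv E E'.
Proof.
split=> [/eqquotP/asboolP //|h].
by apply/eqquotP/asboolP.
Qed.

Lemma ycls_mor1 t B X (E E' : yseq t B X) :
  yseq_mor E E' (idm X) (idm B) -> ycls E = ycls E'.
Proof. by move=> h; apply/ycls_eqP; exact: rst_step. Qed.

Lemma ycls_compat T t B X (F : yseq t B X -> T) :
  (forall E E', yseq_mor E E' (idm X) (idm B) -> F E = F E') ->
  forall E, F (repr (ycls E)) = F E.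
Proof.
move=> h E; have H E1 E2 : yseq_equiv E1 E2 -> F E1 = F E2.
  by elim=> {E1 E2} [E1 E2 /h|E1|E1 E2 _ ->|E1 E2 E3 _ -> _ ->].
by apply/H/ycls_eqP; exact: reprK.
Qed.

Lemma ypush_cls t B X X' (f : hom X X') (E : yseq t B X) :
  ypush f (ycls E) = ycls (yseq_push f E).
Proof.
rewrite /ypush (ycls_compat (F := fun E => ycls (yseq_push f E))) // => E1 E2 h.
apply: ycls_mor1; apply: yseq_push_univ.
by have := yseq_mor_comp h (yseq_push_mor f E2); rewrite compm1 comp1m.
Qed.

Lemma ypull_cls t B B' X (g : hom B' B) (E : yseq t B X) :
  ypull g (ycls E) = ycls (yseq_pull g E).
Proof.
rewrite /ypull (ycls_compat (F := fun E => ycls (yseq_pull g E))) // => E1 E2 h.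
apply: ycls_mor1; apply: yseq_pull_univ.
by have := yseq_mor_comp (yseq_pull_mor g E1) h; rewrite compm1 comp1m.
Qed.

Lemma bipmap1 X Y : bipmap (idm X) (idm Y) = idm (bip X Y).
Proof. exact: bmap1. Qed.

Lemma ysum_cls t B X B' X' (E : yseq t B X) (E' : yseq t B' X') :
  ysum (ycls E) (ycls E') = ycls (yseq_sum E E').
Proof.
rewrite /ysum (ycls_compat (F := fun E => ycls (yseq_sum E _))).
  rewrite (ycls_compat (F := fun E' => ycls (yseq_sum E E'))) // => E1 E2 h.
  apply: ycls_mor1; rewrite -!bipmap1.
  by apply: yseq_sum_mor => //; exact: yseq_mor_id.
move=> E1 E2 h; apply: ycls_mor1; rewrite -!bipmap1.
by apply: yseq_sum_mor => //; exact: yseq_mor_id.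
Qed.

Lemma ycls_mor t B X B' X' (E : yseq t B X) (E' : yseq t B' X') f g :
  yseq_mor E E' f g -> ypush f (ycls E) = ypull g (ycls E').
Proof.
move=> h; rewrite ypush_cls ypull_cls; apply: ycls_mor1.
by apply: yseq_pull_univ; exact: yseq_push_univ.
Qed.

Lemma ypush1 t B X (x : yext t B X) : ypush (idm X) x = x.
Proof.
elim/ycls_ind: x => E; rewrite ypush_cls.
by apply: ycls_mor1; apply: yseq_push_univ; exact: yseq_mor_id.
Qed.

Lemma ypull1 t B X (x : yext t B X) : ypull (idm B) x = x.
Proof.
elim/ycls_ind: x => E; rewrite ypull_cls.
by apply/esym/ycls_mor1; apply: yseq_pull_univ; exact: yseq_mor_id.
Qed.

Lemma ypushM t B X X' X'' (g : hom X' X'') (f : hom X X') (x : yext t B X) :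
  ypush (g \c f) x = ypush g (ypush f x).
Proof.
elim/ycls_ind: x => E; rewrite !ypush_cls; apply: ycls_mor1.
apply: yseq_push_univ.
have := yseq_mor_comp (yseq_push_mor f E) (yseq_push_mor g (yseq_push f E)).
by rewrite comp1m.
Qed.

Lemma ypullM t B B' B'' X (g : hom B' B) (f : hom B'' B') (x : yext t B X) :
  ypull (g \c f) x = ypull f (ypull g x).
Proof.
elim/ycls_ind: x => E; rewrite !ypull_cls; apply/esym/ycls_mor1.
apply: yseq_pull_univ.
have := yseq_mor_comp (yseq_pull_mor f (yseq_pull g E)) (yseq_pull_mor g E).
by rewrite comp1m.
Qed.

Lemma ypush_pull t B B' X X' (f : hom X X') (g : hom B' B) (x : yext t B X) :
  ypush f (ypull g x) = ypull g (ypush f x).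
Proof.
elim/ycls_ind: x => E; rewrite ypull_cls [ypush f (ycls E)]ypush_cls.
apply: ycls_mor.
have := yseq_mor_comp (yseq_pull_mor g E) (yseq_push_mor f E).
by rewrite compm1 comp1m.
Qed.

Lemma ysum_push t B1 X1 B2 X2 X1' X2' (f1 : hom X1 X1') (f2 : hom X2 X2')
    (x1 : yext t B1 X1) (x2 : yext t B2 X2) :
  ysum (ypush f1 x1) (ypush f2 x2) = ypush (bipmap f1 f2) (ysum x1 x2).
Proof.
elim/ycls_ind: x1 => E1; elim/ycls_ind: x2 => E2.
rewrite (ypush_cls f1) (ypush_cls f2) !ysum_cls -[LHS]ypull1; apply/esym/ycls_mor.
by rewrite -bipmap1; apply: yseq_sum_mor; exact: yseq_push_mor.
Qed.

Lemma ysum_pull t B1 X1 B2 X2 B1' B2' (g1 : hom B1' B1) (g2 : hom B2' B2)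
    (x1 : yext t B1 X1) (x2 : yext t B2 X2) :
  ysum (ypull g1 x1) (ypull g2 x2) = ypull (bipmap g1 g2) (ysum x1 x2).
Proof.
elim/ycls_ind: x1 => E1; elim/ycls_ind: x2 => E2.
rewrite (ypull_cls g1) (ypull_cls g2) !ysum_cls -[LHS]ypush1; apply: ycls_mor.
by rewrite -bipmap1; apply: yseq_sum_mor; exact: yseq_pull_mor.
Qed.

Lemma ydiag t B X (x : yext t B X) :
  ypush (diag (bip X X)) x = ypull (diag (bip B B)) (ysum x x).
Proof.
by elim/ycls_ind: x => E; rewrite ysum_cls; apply: ycls_mor; exact: yseq_diag_mor.
Qed.

Lemma ycodiag t B X (x : yext t B X) :
  ypush (codiag (bip X X)) (ysum x x) = ypull (codiag (bip B B)) x.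
Proof.
by elim/ycls_ind: x => E; rewrite ysum_cls; apply: ycls_mor;
  exact: yseq_codiag_mor.
Qed.

Lemma yswap t B X B' X' (x : yext t B X) (x' : yext t B' X') :
  ypush (bipswap X X') (ysum x x') = ypull (bipswap B B') (ysum x' x).
Proof.
elim/ycls_ind: x => E; elim/ycls_ind: x' => E'.
by rewrite !ysum_cls; apply: ycls_mor; exact: yseq_swap_mor.
Qed.

Lemma yassoc t B X B' X' B'' X'' (x : yext t B X) (x' : yext t B' X')
    (x'' : yext t B'' X'') :
  ypush (bipassoc X X' X'') (ysum (ysum x x') x'') =
  ypull (bipassoc B B' B'') (ysum x (ysum x' x'')).
Proof.
elim/ycls_ind: x => E; elim/ycls_ind: x' => E'; elim/ycls_ind: x'' => E''.
by rewrite !ysum_cls; apply: ycls_mor; exact: yseq_assoc_mor.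
Qed.

Lemma ypush0 t B X X' (x : yext t B X) : ypush (0 : hom X X') x = yzero t B X'.
Proof.
elim/ycls_ind: x => E; rewrite -[RHS]ypull1; apply: ycls_mor.
exact: yseq_split_mor.
Qed.

Lemma yaddC t B X : commutative (@yadd t B X).
Proof.
move=> x y; rewrite /yadd.
have {1}-> : codiag (bip X X) = codiag (bip X X) \c bipswap X X.
  by rewrite /codiag /bipswap !(compDm, compmD) -?compA !bipE addrC.
rewrite ypushM ypush_pull yswap -ypullM; congr (ypush _ (ypull _ _)).
by rewrite /diag /bipswap !(compDm, compmD) -?compA !bipE addrC.
Qed.

Lemma yaddA t B X : associative (@yadd t B X).
Proof.
move=> x y z.
have -> : yadd x (yadd y z) =
    ypush (codiag (bip X X) \c bipmap (idm X) (codiag (bip X X)))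
      (ypull (bipmap (idm B) (diag (bip B B)) \c diag (bip B B))
        (ysum x (ysum y z))).
  rewrite {1}/yadd -[x in LHS]ypull1 -[ypull _ x]ypush1 ysum_push ysum_pull.
  by rewrite ypushM ypullM !ypush_pull.
have -> : yadd (yadd x y) z =
    ypush (codiag (bip X X) \c bipmap (codiag (bip X X)) (idm X))
      (ypull (bipmap (diag (bip B B)) (idm B) \c diag (bip B B))
        (ysum (ysum x y) z)).
  rewrite {1}/yadd -[z in LHS]ypull1 -[ypull _ z]ypush1 ysum_push ysum_pull.
  by rewrite ypushM ypullM !ypush_pull.
have -> : codiag (bip X X) \c bipmap (codiag (bip X X)) (idm X) =
    codiag (bip X X) \c bipmap (idm X) (codiag (bip X X)) \c bipassoc X X X.
  rewrite /codiag /bipmap /bmap /bipassoc.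
  by rewrite !(compDm, compmD) -?compA !bipE
    ?(compDm, compmD) -?compA ?bipE addrA.
rewrite [in RHS]ypushM (ypush_pull (bipassoc X X X)) yassoc -!ypullM.
congr (ypush _ (ypull _ _)).
rewrite /diag /bipmap /bmap /bipassoc.
by rewrite !(compDm, compmD) -?compA !bipE ?(compDm, compmD) -?compA ?bipE addrA.
Qed.

Lemma ypush_add t B X X' (f f' : hom X X') (x : yext t B X) :
  ypush (f + f') x = yadd (ypush f x) (ypush f' x).
Proof.
rewrite /yadd ysum_push -ypush_pull -ydiag -!ypushM; congr (ypush _ _).
by rewrite /codiag /bipmap /bmap /diag !(compDm, compmD) -?compA !bipE.
Qed.

Lemma ypull_add t B B' X (g g' : hom B' B) (x : yext t B X) :
  ypull (g + g') x = yadd (ypull g x) (ypull g' x).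
Proof.
rewrite /yadd ysum_pull -ypullM ypush_pull ycodiag -ypullM; congr (ypull _ _).
by rewrite /codiag /bipmap /bmap /diag !(compDm, compmD) -?compA !bipE.
Qed.

Lemma ypushD t B X X' (f : hom X X') (x y : yext t B X) :
  ypush f (yadd x y) = yadd (ypush f x) (ypush f y).
Proof.
rewrite /yadd ysum_push -ypush_pull -!ypushM; congr (ypush _ _).
by rewrite /codiag /bipmap /bmap !(compDm, compmD) -?compA !bipE.
Qed.

Lemma ypullD t B B' X (g : hom B' B) (x y : yext t B X) :
  ypull g (yadd x y) = yadd (ypull g x) (ypull g y).
Proof.
rewrite /yadd ysum_pull -ypush_pull -!ypullM; congr (ypush _ (ypull _ _)).
by rewrite /diag /bipmap /bmap !(compDm, compmD) -?compA !bipE.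
Qed.

Lemma yadd0 t B X : left_id (yzero t B X) (@yadd t B X).
Proof.
move=> x; rewrite -(ypush0 X x) -[in X in yadd _ X](ypush1 x) -ypush_add add0r.
exact: ypush1.
Qed.

Lemma yaddN t B X : left_inverse (yzero t B X) (@yopp t B X) (@yadd t B X).
Proof.
move=> x; rewrite -[in X in yadd _ X](ypush1 x) /yopp -ypush_add addNr.
exact: ypush0.
Qed.

HB.instance Definition _ t B X :=
  GRing.isZmodule.Build (yext t B X) (@yaddA t B X) (@yaddC t B X)
    (@yadd0 t B X) (@yaddN t B X).

End Yoneda.

Section Ext.
Variables (A : abelian) (C : exact_sub A).
Implicit Types X Y B K : C.

(* [yext t] is the group of extensions of length t.+1; in degree 0, Ext is Hom. *)
Definition Ext (t : nat) B X : zmodType :=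
  if t is t'.+1 then yext t' B X else hom B X.

Definition ext_push t B X X' (f : hom X X') : Ext t B X -> Ext t B X' :=
  if t is t'.+1 then fun x : yext t' B X => ypush f x else fun x => f \c x.

Definition ext_pull t B B' X (g : hom B' B) : Ext t B X -> Ext t B' X :=
  if t is t'.+1 then fun x : yext t' B X => ypull g x else fun x => x \c g.

Lemma ext_push1 t B X (x : Ext t B X) : ext_push (idm X) x = x.
Proof. by case: t x => [|t] x; [exact: comp1m | exact: ypush1]. Qed.

Lemma ext_pull1 t B X (x : Ext t B X) : ext_pull (idm B) x = x.
Proof. by case: t x => [|t] x; [exact: compm1 | exact: ypull1]. Qed.

Lemma ext_pushM t B X X' X'' (g : hom X' X'') (f : hom X X') (x : Ext t B X) :
  ext_push (g \c f) x = ext_push g (ext_push f x).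
Proof. by case: t x => [|t] x; [exact/esym/compA | exact: ypushM]. Qed.

Lemma ext_pullM t B B' B'' X (g : hom B' B) (f : hom B'' B') (x : Ext t B X) :
  ext_pull (g \c f) x = ext_pull f (ext_pull g x).
Proof. by case: t x => [|t] x; [exact: compA | exact: ypullM]. Qed.

Lemma ext_push_pull t B B' X X' (f : hom X X') (g : hom B' B) (x : Ext t B X) :
  ext_push f (ext_pull g x) = ext_pull g (ext_push f x).
Proof. by case: t x => [|t] x; [exact: compA | exact: ypush_pull]. Qed.

Lemma ext_pushD t B X X' (f : hom X X') (x y : Ext t B X) :
  ext_push f (x + y) = ext_push f x + ext_push f y.
Proof. by case: t x y => [|t] x y; [exact: compmD | exact: ypushD]. Qed.

Lemma ext_pullD t B B' X (g : hom B' B) (x y : Ext t B X) :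
  ext_pull g (x + y) = ext_pull g x + ext_pull g y.
Proof. by case: t x y => [|t] x y; [exact: compDm | exact: ypullD]. Qed.

Lemma ext_push_add t B X X' (f f' : hom X X') (x : Ext t B X) :
  ext_push (f + f') x = ext_push f x + ext_push f' x.
Proof. by case: t x => [|t] x; [exact: compDm | exact: ypush_add]. Qed.

Lemma ext_pull_add t B B' X (g g' : hom B' B) (x : Ext t B X) :
  ext_pull (g + g') x = ext_pull g x + ext_pull g' x.
Proof. by case: t x => [|t] x; [exact: compmD | exact: ypull_add]. Qed.

Lemma ext_push_zmod t B X X' (f : hom X X') :
  zmod_morphism (@ext_push t B X X' f).
Proof.
move=> x y; apply/eqP; rewrite eq_sym subr_eq -ext_pushD.
by rewrite subrK.
Qed.

Lemma ext_pull_zmod t B B' X (g : hom B' B) :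
  zmod_morphism (@ext_pull t B B' X g).
Proof.
move=> x y; apply/eqP; rewrite eq_sym subr_eq -ext_pullD.
by rewrite subrK.
Qed.

Lemma ext_push0 t B X X' (x : Ext t B X) : ext_push (0 : hom X X') x = 0.
Proof.
apply: (addrI (ext_push 0 x)).
by rewrite -[in LHS]ext_push_add !addr0.
Qed.

Lemma ext_pull0 t B B' X (x : Ext t B X) : ext_pull (0 : hom B' B) x = 0.
Proof.
apply: (addrI (ext_pull 0 x)).
by rewrite -[in LHS]ext_pull_add !addr0.
Qed.

Lemma ext_pull_eq0 t B B' X (g : hom B' B) :
  ext_pull g (0 : Ext t B X) = 0.
Proof. by rewrite -(subrr (0 : Ext t B X)) ext_pull_zmod subrr. Qed.

Definition nproj (n : nat) (P : C) : Prop :=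
  forall (i : nat) (X : C), (n < i)%N -> forall x : Ext i P X, x = 0.

Definition ninj (n : nat) (I : C) : Prop :=
  forall (i : nat) (X : C), (n < i)%N -> forall x : Ext i X I, x = 0.

Definition enough_nproj (n : nat) : Prop :=
  forall X : C, exists (K : C) (E : conflation X K), nproj n (mid E).

Definition enough_ninj (n : nat) : Prop :=
  forall X : C, exists (K : C) (E : conflation K X), ninj n (mid E).

Definition nFrobenius (n : nat) : Prop :=
  [/\ enough_nproj n, enough_ninj n & forall X : C, nproj n X <-> ninj n X].

(* d : Ext k N O is the class of a syzygy sequence of N with respect to
   n-projectives, and O is the corresponding k-th syzygy of N. *)
Inductive syzygy (n : nat) : forall (k : nat) (N O : C), Ext k N O -> Prop :=
| syzygy0 (N : C) : @syzygy n 0 N N (idm N)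
| syzygyS (k : nat) (N O : C) (E : yseq k N O) :
    yseq_mids (nproj n) E -> @syzygy n k.+1 N O (ycls E).

Lemma nproj_zero n Z : is_zero Z -> nproj n Z.
Proof. by move=> z i X _ x; rewrite -(ext_pull1 x) z ext_pull0. Qed.

Lemma nproj_bip n P P' : nproj n P -> nproj n P' -> nproj n (bip P P').
Proof.
move=> h h' i X ni x; rewrite -(ext_pull1 x) -(inprD (bip P P')) ext_pull_add.
rewrite (ext_pullM (in1 _)) (ext_pullM (in2 _)).
have -> : ext_pull (in1 (bip P P')) x = 0 by exact: h.
have -> : ext_pull (in2 (bip P P')) x = 0 by exact: h'.
by rewrite !ext_pull_eq0 addr0.
Qed.

Definition pushP (n k : nat) (M O : C) : {pred Ext k M O} :=
  fun x => `[< exists (P : C) (f : hom P O) (b : Ext k M P),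
                 nproj n P /\ x = ext_push f b >].

Arguments pushP n k M O _ : clear implicits.

Lemma pushP_closed n k M O : zmod_closed (pushP n k M O).
Proof.
split.
  apply/asboolP; exists (zob C), 0, 0; split; first exact/nproj_zero/zobP.
  by rewrite ext_push0.
move=> x y /asboolP[P [f [b [hP ->]]]] /asboolP[P' [f' [b' [hP' ->]]]].
apply/asboolP; exists (bob (bip P P')).
exists (f \c pr1 (bip P P') - f' \c pr2 (bip P P')).
exists (ext_push (in1 (bip P P')) b + ext_push (in2 (bip P P')) b').
split; first exact: nproj_bip.
rewrite ext_pushD -!ext_pushM !(compDm, compNm) -!compA !bipE oppr0 addr0.
congr (_ + _); apply: (addrI (ext_push f' b')).
by rewrite subrr -ext_push_add subrr ext_push0.
Qed.

HB.instance Definition _ n k M O :=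
  GRing.isZmodClosed.Build (Ext k M O) (pushP n k M O)
    (@pushP_closed n k M O).

End Ext.

Arguments pushP {A C} n k M O _.

Record abfunctor (D : preadditive) := AbFunctor {
  fobj :> D -> zmodType;
  fmap : forall X Y : D, hom X Y -> fobj X -> fobj Y;
  fmap_zmod : forall (X Y : D) (f : hom X Y), zmod_morphism (fmap f);
  fmap1 : forall (X : D) (x : fobj X), fmap (idm X) x = x;
  fmapM : forall (X Y Z : D) (g : hom Y Z) (f : hom X Y) (x : fobj X),
    fmap (g \c f) x = fmap g (fmap f x)
}.

Record nattrans (D : preadditive) (F G : abfunctor D) := NatTrans {
  nt_app :> forall X : D, F X -> G X;
  nt_zmod : forall X : D, zmod_morphism (@nt_app X);
  nt_natural : forall (X Y : D) (f : hom X Y) (x : F X),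
    nt_app (fmap f x) = fmap f (nt_app x)
}.

HB.instance Definition _ D F G := gen_eqMixin (@nattrans D F G).
HB.instance Definition _ D F G := gen_choiceMixin (@nattrans D F G).

Section NatGroup.
Variables (D : preadditive) (F G : abfunctor D).
Implicit Types p q : nattrans F G.

Lemma nattrans_eq p q : (forall X (x : F X), p X x = q X x) -> p = q.
Proof.
case: p q => [p pz pn] [q qz qn] /= e.
have {}e : p = q by apply: functional_extensionality_dep => X; apply/funext/e.
case: _ / e in qz qn *.
by congr NatTrans; exact: Prop_irrelevance.
Qed.

Lemma fmapD (H : abfunctor D) X Y (f : hom X Y) (x y : H X) :
  fmap f (x + y) = fmap f x + fmap f y.
Proof. by apply/eqP; rewrite -subr_eq -fmap_zmod addrK. Qed.

Lemma fmap0 (H : abfunctor D) X Y (f : hom X Y) : fmap f (0 : H X) = 0.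
Proof. by rewrite -(subrr (0 : H X)) fmap_zmod subrr. Qed.

Fact nt_add_zmod p q X : zmod_morphism (fun x => p X x + q X x).
Proof. by move=> x y; rewrite !nt_zmod opprD addrACA. Qed.
Fact nt_add_natural p q X Y (f : hom X Y) x :
  p Y (fmap f x) + q Y (fmap f x) = fmap f (p X x + q X x).
Proof. by rewrite fmapD !nt_natural. Qed.
Definition nt_add p q : nattrans F G :=
  NatTrans (nt_add_zmod p q) (nt_add_natural p q).

Fact nt_zero_zmod X : zmod_morphism (fun _ : F X => 0 : G X).
Proof. by move=> x y; rewrite subrr. Qed.
Fact nt_zero_natural X Y (f : hom X Y) (x : F X) : 0 = fmap f (0 : G X).
Proof. by rewrite fmap0. Qed.
Definition nt_zero : nattrans F G := NatTrans nt_zero_zmod nt_zero_natural.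

Fact nt_opp_zmod p X : zmod_morphism (fun x => - p X x).
Proof. by move=> x y; rewrite nt_zmod opprD. Qed.
Fact nt_opp_natural p X Y (f : hom X Y) x :
  - p Y (fmap f x) = fmap f (- p X x).
Proof. by rewrite nt_natural -[- p X x]sub0r fmap_zmod fmap0 sub0r. Qed.
Definition nt_opp p : nattrans F G :=
  NatTrans (nt_opp_zmod p) (nt_opp_natural p).

Fact nt_addA : associative nt_add.
Proof. by move=> p q r; apply: nattrans_eq => X x /=; rewrite addrA. Qed.
Fact nt_addC : commutative nt_add.
Proof. by move=> p q; apply: nattrans_eq => X x /=; rewrite addrC. Qed.
Fact nt_add0 : left_id nt_zero nt_add.
Proof. by move=> p; apply: nattrans_eq => X x /=; rewrite add0r. Qed.
Fact nt_addN : left_inverse nt_zero nt_opp nt_add.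
Proof. by move=> p; apply: nattrans_eq => X x /=; rewrite addNr. Qed.

HB.instance Definition _ :=
  GRing.isZmodule.Build (nattrans F G) nt_addA nt_addC nt_add0 nt_addN.

End NatGroup.

Definition Nat (D : preadditive) (F G : abfunctor D) : zmodType :=
  nattrans F G.

Section ExtFunctors.
Variables (A : abelian) (C : exact_sub A).

(* Ext^t(N, -) *)
Definition Ext_cov (t : nat) (N : C) : abfunctor C :=
  @AbFunctor C (fun X => Ext t N X) (fun X Y f => ext_push f)
    (fun X Y f => ext_push_zmod f) (fun X x => ext_push1 x)
    (fun X Y Z g f x => ext_pushM g f x).

(* Ext^t(-, M); contravariant functors on C are functors on opcat C. *)
Definition Ext_con (t : nat) (M : C) : abfunctor (opcat C) :=
  @AbFunctor (opcat C) (fun X => Ext t (X : C) M)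
    (fun X Y f => @ext_pull A C t X Y M f)
    (fun X Y f => @ext_pull_zmod A C t X Y M f) (fun X x => ext_pull1 x)
    (fun X Y Z g f x => @ext_pullM A C t X Y Z M f g x).

End ExtFunctors.

Definition group_iso (U V : zmodType) : Prop :=
  exists f : {additive U -> V}, bijective f.

Definition Ext_mod_pushP (A : abelian) (C : exact_sub A) (n k : nat)
    (M O : C) : zmodType := Quotient.quot (pushP n k M O).

(* Main.v *)
(** Since the n-projectives are the n-injectives, splicing on the left, or on
    the right, with a sequence whose middle terms are n-projective is bijective
    on Ext^s for s > n.  Take such sequences of length k+1: d from Z to N, obtained
    by splicing a conflation Z -> P -> ON with the syzygy sequence of N, and e
    from M to S.
    An element u of Ext^(k+1)(S, N) acts on Ext^(k+1)(N, -) by x |-> (xu)e^-1,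
    and an element v of Ext^(k+1)(M, Z) acts on Ext^(k+1)(-, M) by
    x |-> d^-1(vx).  Every natural transformation arises in this way exactly
    once, because any two elements of Ext^(k+1)(N, -) are push-outs of a common
    sequence with n-projective middle terms, and dually.  The two parameter
    groups are identified by ve = du.  Finally Ext^k(M, ON) maps onto
    Ext^(k+1)(M, Z) by splicing with Z -> P -> ON.  The kernel consists of the
    push-outs along P -> ON; it contains all push-outs along morphisms from
    n-projectives because a splice of an extension of an n-projective vanishes,
    by dimension shifting. *)
From HB Require Import structures.
From mathcomp Require Import all_boot all_algebra.
From mathcomp Require Import boolp.
Require Import Defs.

Set Implicit Arguments.
Unset Strict Implicit.
Unset Printing Implicit Defensive.

Import GRing.Theory.
Local Open Scope ring_scope.
Local Open Scope quotient_scope.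

(** * Short exact sequences in an abelian category *)

Lemma is_cokernel_epi (D : preadditive) (X Y Q : D) (f : hom X Y)
    (p : hom Y Q) :
  is_cokernel f p -> is_epi p.
Proof. exact: (@is_kernel_mono (opcat D)). Qed.

(** The mono [i] is the kernel of some [g], and [g] factors through the cokernel [p]; so whatever
    [p] kills is killed by [g]. *)
Lemma mono_cokernel_kernel (D : preadditive) (hD : is_abelian D) (X Y Q : D)
    (i : hom X Y) (p : hom Y Q) :
  is_mono i -> is_cokernel i p -> is_kernel p i.
Proof.
move=> mi [pi0 cp]; split=> // T t pt0.
have [Z [g [gi0 kg]]] := abelian_mono hD mi.
have [g' [eg _]] := cp _ g gi0.
by apply: kg; rewrite -eg -compA pt0 compm0.
Qed.

Lemma epi_kernel_cokernel (D : preadditive) (hD : is_abelian D) (X Y Q : D)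
    (i : hom X Y) (p : hom Y Q) :
  is_epi p -> is_kernel p i -> is_cokernel i p.
Proof. exact: (@mono_cokernel_kernel _ (is_abelian_op hD)). Qed.

(** The maps [h] and [p] are jointly monic because [i'] is mono. For existence, [b] is lifted to [U]
    after pulling [p] back along it; the error against [a] factors through [i'] and is corrected by
    means of [i]. The corrected lift descends along the epi [r] by joint monicity. *)
Lemma ses_mor_pullback (D : preadditive) (hD : is_abelian D)
    (X U B U' B' : D) (i : hom X U) (p : hom U B) (i' : hom X U')
    (p' : hom U' B') (h : hom U U') (k : hom B B') :
  short_exact i p -> short_exact i' p' -> h \c i = i' -> p' \c h = k \c p ->
  is_pullback p' k h p.
Proof.
move=> se se' hi hp; split=> // T a b eab.
have [[pi0 ki] cp] := se; have [[pi0' ki'] cp'] := se'.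
have mi' : is_mono i' by case: se' => /is_kernel_mono.
have uniq (V : D) (w : hom V U) : h \c w = 0 -> p \c w = 0 -> w = 0.
  move=> hw pw; have [s [es _]] := ki _ w pw.
  suff s0 : s = 0 by rewrite -es s0 compm0.
  by apply: mi'; rewrite -hi -compA es hw compm0.
have [P [j [r [c [[_ cr] [pc _] _]]]]] := ses_pullback hD b se.
have [|s [es _]] := ki' _ (h \c c - a \c r).
  by rewrite compmD compmN !compA hp eab -!compA pc subrr.
have hc : h \c (c - i \c s) = a \c r.
  by rewrite compmD compmN compA hi es opprB addrC subrK.
have pc' : p \c (c - i \c s) = b \c r.
  by rewrite compmD compmN compA pi0 comp0m subr0.
have rj0 : r \c j = 0 by case: cr.
have [|w [ew _]] := cr.2 _ (c - i \c s).
  by apply: uniq; rewrite compA ?hc ?pc' -compA rj0 compm0.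
have er := is_cokernel_epi cr.
have hw : h \c w = a by apply: er; rewrite -compA ew.
have pw : p \c w = b by apply: er; rewrite -compA ew.
exists w; split=> // w' [hw' pw'].
apply/eqP; rewrite -subr_eq0; apply/eqP.
by apply: uniq; rewrite compmD compmN ?hw ?pw ?hw' ?pw' subrr.
Qed.

(* The Mayer-Vietoris sequence of the pull-back square of [p'] and [k]. *)
Lemma ses_mayer_vietoris (D : preadditive) (hD : is_abelian D)
    (X U B U' B' : D) (i : hom X U) (p : hom U B) (i' : hom X U')
    (p' : hom U' B') (h : hom U U') (k : hom B B') (S : biproduct B U') :
  short_exact i p -> short_exact i' p' -> h \c i = i' -> p' \c h = k \c p ->
  short_exact (in1 S \c p + in2 S \c h) (k \c pr1 S - p' \c pr2 S).
Proof.
move=> se se' hi hp; have [_ pb] := ses_mor_pullback hD se se' hi hp.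
have e1 (T : D) (w : hom T U) :
  pr1 S \c ((in1 S \c p + in2 S \c h) \c w) = p \c w.
  by rewrite compA compmD !bipE.
have e2 (T : D) (w : hom T U) :
  pr2 S \c ((in1 S \c p + in2 S \c h) \c w) = h \c w.
  by rewrite compA compmD !bipE.
have ki : is_kernel (k \c pr1 S - p' \c pr2 S) (in1 S \c p + in2 S \c h).
  split.
    by rewrite compDm compNm -!compA !compmD !bipE hp subrr.
  move=> T t; rewrite compDm compNm -!compA => /subr0_eq/esym/pb.
  case=> w [[hw pw] uw]; exists w; split.
    by apply: (bip_eqr (b := S)); rewrite ?e1 ?e2.
  by move=> w' ew'; apply: uw; rewrite -ew' e1 e2.
split=> //; apply: (epi_kernel_cokernel hD) ki.
(* On the second summand the map is [- p']; as that is epi, so is the whole map. *)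
have ep' : is_epi p' by case: se' => _ /is_cokernel_epi.
move=> T s t /(congr1 (fun g => g \c in2 S)).
rewrite -!compA !(compDm, compNm) -!compA !bipE !compmN => /oppr_inj.
exact: ep'.
Qed.

Lemma ses_mayer_vietoris_dual (D : preadditive) (hD : is_abelian D)
    (Y U Y' U' B : D) (i : hom Y U) (p : hom U B) (i' : hom Y' U')
    (p' : hom U' B) (k : hom Y Y') (h : hom U U') (S : biproduct Y' U) :
  short_exact i p -> short_exact i' p' -> h \c i = i' \c k -> p' \c h = p ->
  short_exact (in1 S \c k - in2 S \c i) (i' \c pr1 S + h \c pr2 S).
Proof.
move=> [ki cp] [ki' cp'] hi hp.
have [c d] := @ses_mayer_vietoris _ (is_abelian_op hD) _ _ _ _ _ p' i' p i h k
  (opbip S) (conj cp' ki') (conj cp ki) hp hi.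
by split.
Qed.

(** A Noether isomorphism: pushing [j] out along the epi [p] divides [V] by the image of [U]. *)
Lemma ses_pushout_epi (D : preadditive) (hD : is_abelian D)
    (U W B V K V' : D) (i : hom U W) (p : hom W B) (j : hom W V)
    (q : hom V K) (h : hom V V') (j' : hom B V') :
  short_exact i p -> short_exact j q -> is_pushout j p h j' ->
  short_exact (j \c i) h.
Proof.
move=> [ki cp] [kj _] [e po].
have mi := is_kernel_mono ki; have mj := is_kernel_mono kj.
have ch : is_cokernel (j \c i) h.
  split=> [|T t tji0]; first by rewrite compA e -compA ki.1 compm0.
  have [v [ev _]] := cp.2 _ (t \c j) (etrans (esym (compA _ _ _)) tji0).
  have [w [[w1 w2] uw]] := po _ t v (esym ev).
  exists w; split=> // w' ew'; apply: uw; split=> //.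
  by apply: (is_cokernel_epi cp); rewrite -compA -e compA ew' ev.
split=> //; apply: (mono_cokernel_kernel hD) ch => T s t.
by rewrite -!compA => /mj/mi.
Qed.

Lemma ses_pullback_mono (D : preadditive) (hD : is_abelian D)
    (Y W B X V V' : D) (i : hom Y W) (p : hom W B) (j : hom X V)
    (q : hom V W) (h : hom V' V) (q' : hom V' Y) :
  short_exact i p -> short_exact j q -> is_pullback q i h q' ->
  short_exact h (p \c q).
Proof.
move=> [ki cp] [kj cq] pb.
by have [] := @ses_pushout_epi _ (is_abelian_op hD) _ _ _ _ _ _ p i q j h q'
  (conj cp ki) (conj cq kj) pb.
Qed.

(** * The Yoneda product of extensions of positive length *)

Section Product.
Variables (A : abelian) (C : exact_sub A).
Implicit Types X Y B K L : C.

(** An index is one less than the length, so lengths [s.+1] and [t.+1] splice to index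
    [(s + t).+1]. *)
Fixpoint yseq_prod s t : forall X Y B, yseq s Y X -> yseq t B Y ->
    yseq (s + t).+1 B X :=
  if s is s'.+1 then fun X Y B E R =>
    ysplice (projT2 E).1 (yseq_prod (projT2 E).2 R)
  else fun X Y B E R => ysplice E R.

(** The type [yseq] exposes the conflation at the start [X]; this gives access to the one at the end
    [B], as contravariant arguments require. *)
Fixpoint yseq_rcons s : forall X Y B, yseq s Y X -> conflation B Y ->
    yseq s.+1 B X :=
  if s is s'.+1 then fun X Y B E F =>
    ysplice (projT2 E).1 (yseq_rcons (projT2 E).2 F)
  else fun X Y B E F => @ysplice A C 0 B Y X E F.

Lemma yseq_prod_mor s t : forall X Y B X' Y' B' (E : yseq s Y X)
    (R : yseq t B Y) (E' : yseq s Y' X') (R' : yseq t B' Y') f g h,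
  yseq_mor E E' f g -> yseq_mor R R' g h ->
  yseq_mor (yseq_prod E R) (yseq_prod E' R') f h.
Proof.
elim: s => [|s IH] X Y B X' Y' B' E R E' R' f g h; first by exists g.
by case=> k [h1 h2] h3; exists k; split=> //; exact: IH h2 h3.
Qed.

Lemma yseq_prod_sum s t : forall X Y B X' Y' B' (E : yseq s Y X)
    (R : yseq t B Y) (E' : yseq s Y' X') (R' : yseq t B' Y'),
  yseq_sum (yseq_prod E R) (yseq_prod E' R') =
  yseq_prod (yseq_sum E E') (yseq_sum R R').
Proof.
elim: s => [|s IH] X Y B X' Y' B' E R E' R' //.
exact: congr1 (IH _ _ _ _ _ _ _ _ _ _).
Qed.

Lemma yseq_rcons_inv s : forall X B (G : yseq s.+1 B X),
  exists K (E : yseq s K X) (F : conflation B K), G = yseq_rcons E F.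
Proof.
elim: s => [|s IH] X B [K [E G]]; first by exists K, E, G.
have [L [E' [F ->]]] := IH _ _ G.
by exists L, (ysplice E E'), F.
Qed.

Lemma yseq_rcons_mor s : forall X Y B X' Y' B' (E : yseq s Y X)
    (F : conflation B Y) (E' : yseq s Y' X') (F' : conflation B' Y') f h,
  yseq_mor (yseq_rcons E F) (yseq_rcons E' F') f h <->
  exists g, yseq_mor E E' f g /\ conf_mor F F' g h.
Proof.
elim: s => [|s IH] X Y B X' Y' B' E F E' F' f h; first by [].
split=> [[k [h1 /IH[g [h2 h3]]]]|[g [[k [h1 h2]] h3]]].
  by exists g; split=> //; exists k.
by exists k; split=> //; apply/IH; exists g.
Qed.

(** Transport between indices such as [s + 0] and [s], which are equal but not convertible. *)
Definition ycast s t (e : s = t) B X (G : yseq s B X) : yseq t B X :=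
  ecast i (yseq i B X) e G.

Lemma ycast_splice s t (e : s = t) B K X (E : conflation K X)
    (R : yseq s B K) :
  ysplice E (ycast e R) = ycast (congr1 S e) (ysplice E R).
Proof. by case: _ / e. Qed.

Lemma ycast_id s (e : s = s) B X (G : yseq s B X) : ycast e G = G.
Proof. by rewrite (eq_irrelevance e erefl). Qed.

Lemma ycast_irr s t (e e' : s = t) B X (G : yseq s B X) :
  ycast e G = ycast e' G.
Proof. by rewrite (eq_irrelevance e e'). Qed.

Lemma yseq_prod0 s : forall (e : s.+1 = (s + 0).+1) X Y B (E : yseq s Y X)
    (F : yseq 0 B Y), yseq_prod E F = ycast e (yseq_rcons E F).
Proof.
elim: s => [|s IH] e X Y B E F /=; first by rewrite ycast_id.
have [e'] := e; rewrite (IH (congr1 S e')) ycast_splice.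
exact: (ycast_irr _ e (ysplice _ _)).
Qed.

Lemma yseq_prodS s t : forall (e : (s.+1 + t).+1 = (s + t.+1).+1) X Y B L
    (E : yseq s Y X) (F : conflation L Y) (R : yseq t B L),
  yseq_prod E (ysplice F R) = ycast e (yseq_prod (yseq_rcons E F) R).
Proof.
elim: s => [|s IH] e X Y B L E F R /=; first by rewrite ycast_id.
have [e'] := e; rewrite (IH (congr1 S e')) ycast_splice.
exact: (ycast_irr _ e (ysplice _ _)).
Qed.

Definition yprod s t X Y B (x : yext s Y X) (u : yext t B Y) :
  yext (s + t).+1 B X := ycls (yseq_prod (repr x) (repr u)).

Lemma yprod_cls s t X Y B (E : yseq s Y X) (R : yseq t B Y) :
  yprod (ycls E) (ycls R) = ycls (yseq_prod E R).
Proof.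
rewrite /yprod (ycls_compat (F := fun E => ycls (yseq_prod E _))).
  rewrite (ycls_compat (F := fun R => ycls (yseq_prod E R))) // => R1 R2 h.
  by apply: ycls_mor1; apply: yseq_prod_mor h; exact: yseq_mor_id.
move=> E1 E2 h; apply: ycls_mor1.
by apply: (yseq_prod_mor h); exact: yseq_mor_id.
Qed.

Lemma ycls_splice t B K X (E : conflation K X) (R : yseq t B K) :
  @ycls _ _ t.+1 _ _ (existT _ K (E, R)) = yprod (@ycls _ _ 0 _ _ E) (ycls R).
Proof. by rewrite yprod_cls. Qed.

Lemma yprod_push s t X X' Y B (f : hom X X') (x : yext s Y X)
    (u : yext t B Y) :
  yprod (ypush f x) u = ypush f (yprod x u).
Proof.
elim/ycls_ind: x => E; elim/ycls_ind: u => R.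
rewrite (ypush_cls f E) !yprod_cls -[LHS]ypull1; apply/esym/ycls_mor.
exact: yseq_prod_mor (yseq_push_mor f E) (yseq_mor_id R).
Qed.

Lemma yprod_pull s t X Y B B' (g : hom B' B) (x : yext s Y X)
    (u : yext t B Y) :
  yprod x (ypull g u) = ypull g (yprod x u).
Proof.
elim/ycls_ind: x => E; elim/ycls_ind: u => R.
rewrite (ypull_cls g R) !yprod_cls -[LHS]ypush1; apply: ycls_mor.
exact: yseq_prod_mor (yseq_mor_id E) (yseq_pull_mor g R).
Qed.

(** The canonical morphisms out of the pull-back and into the push-out both equal [g] at the
    splicing object, so they splice to one morphism. *)
Lemma yprod_mid s t X Y Y' B (g : hom Y' Y) (x : yext s Y X)
    (u : yext t B Y') :
  yprod (ypull g x) u = yprod x (ypush g u).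
Proof.
elim/ycls_ind: x => E; elim/ycls_ind: u => R.
rewrite (ypull_cls g E) (ypush_cls g R) !yprod_cls; apply: ycls_mor1.
exact: yseq_prod_mor (yseq_pull_mor g E) (yseq_push_mor g R).
Qed.

Lemma yprod_sum s t X Y B X' Y' B' (x : yext s Y X) (u : yext t B Y)
    (x' : yext s Y' X') (u' : yext t B' Y') :
  ysum (yprod x u) (yprod x' u') = yprod (ysum x x') (ysum u u').
Proof.
elim/ycls_ind: x => E; elim/ycls_ind: u => R.
elim/ycls_ind: x' => E'; elim/ycls_ind: u' => R'.
rewrite (yprod_cls E R) (yprod_cls E' R') (ysum_cls E E') (ysum_cls R R').
rewrite ysum_cls.
by rewrite yprod_cls yseq_prod_sum.
Qed.

(** The diagonal of [Y] moves across the product, where [ydiag] turns it into the diagonal of [B]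
    acting on the sum of two copies of [u]. *)
Lemma yprodDl s t X Y B (x x' : yext s Y X) (u : yext t B Y) :
  yprod (x + x') u = yprod x u + yprod x' u.
Proof.
change (yprod (ypush (codiag (bip X X)) (ypull (diag (bip Y Y)) (ysum x x')))
    u = ypush (codiag (bip X X)) (ypull (diag (bip B B))
      (ysum (yprod x u) (yprod x' u)))).
by rewrite yprod_push yprod_mid ydiag yprod_pull yprod_sum.
Qed.

Lemma yprodDr s t X Y B (x : yext s Y X) (u u' : yext t B Y) :
  yprod x (u + u') = yprod x u + yprod x u'.
Proof.
change (yprod x (ypush (codiag (bip Y Y)) (ypull (diag (bip B B))
    (ysum u u'))) = ypush (codiag (bip X X)) (ypull (diag (bip B B))
      (ysum (yprod x u) (yprod x u')))).
by rewrite -yprod_mid -ycodiag yprod_push yprod_pull yprod_sum.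
Qed.

Lemma yprod_zmodl s t X Y B (u : yext t B Y) :
  zmod_morphism (fun x : yext s Y X => yprod x u).
Proof.
by move=> x y; apply/eqP; rewrite eq_sym subr_eq -yprodDl subrK.
Qed.

Lemma yprod_zmodr s t X Y B (x : yext s Y X) :
  zmod_morphism (fun u : yext t B Y => yprod x u).
Proof.
by move=> u v; apply/eqP; rewrite eq_sym subr_eq -yprodDr subrK.
Qed.

Lemma yprod0l s t X Y B (u : yext t B Y) : yprod (0 : yext s Y X) u = 0.
Proof. by rewrite -(subrr 0) yprod_zmodl subrr. Qed.

Lemma yprod0r s t X Y B (x : yext s Y X) : yprod x (0 : yext t B Y) = 0.
Proof. by rewrite -(subrr 0) yprod_zmodr subrr. Qed.

Definition xcast s t (e : s = t) B X (x : yext s B X) : yext t B X :=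
  ecast i (yext i B X) e x.

Lemma xcastK s t (e : s = t) B X :
  cancel (@xcast s t e B X) (@xcast t s (esym e) B X).
Proof. by case: _ / e. Qed.

Lemma xcastKV s t (e : s = t) B X :
  cancel (@xcast t s (esym e) B X) (@xcast s t e B X).
Proof. by case: _ / e. Qed.

Lemma xcast_zmod s t (e : s = t) B X : zmod_morphism (@xcast s t e B X).
Proof. by case: _ / e. Qed.

Lemma xcast_push s t (e : s = t) B X X' (f : hom X X') (x : yext s B X) :
  xcast e (ypush f x) = ypush f (xcast e x).
Proof. by case: _ / e. Qed.

Lemma xcast_pull s t (e : s = t) B B' X (g : hom B' B) (x : yext s B X) :
  xcast e (ypull g x) = ypull g (xcast e x).
Proof. by case: _ / e. Qed.

Lemma xcast_cls s t (e : s = t) B X (G : yseq s B X) :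
  xcast e (ycls G) = ycls (ycast e G).
Proof. by case: _ / e. Qed.

(* [yprod] with a right factor of length 1, with the length of the result in
   the form [s.+1] instead of [(s + 0).+1]. *)
Definition yrprod s X Y B (x : yext s Y X) (u : yext 0 B Y) : yext s.+1 B X :=
  xcast (congr1 S (addn0 s)) (yprod x u).

Lemma yrprod_cls s X Y B (E : yseq s Y X) (F : conflation B Y) :
  yrprod (ycls E) (@ycls _ _ 0 _ _ F) = ycls (yseq_rcons E F).
Proof.
rewrite /yrprod yprod_cls (yseq_prod0 (esym (congr1 S (addn0 s)))).
by rewrite -xcast_cls xcastKV.
Qed.

Lemma yrprod_pull s X Y B B' (g : hom B' B) (x : yext s Y X)
    (u : yext 0 B Y) :
  yrprod x (ypull g u) = ypull g (yrprod x u).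
Proof. by rewrite /yrprod yprod_pull xcast_pull. Qed.

Lemma yrprod_mid s X Y Y' B (g : hom Y' Y) (x : yext s Y X)
    (u : yext 0 B Y') :
  yrprod (ypull g x) u = yrprod x (ypush g u).
Proof. by rewrite /yrprod yprod_mid. Qed.

Lemma yrprod_zmod s X Y B (u : yext 0 B Y) :
  zmod_morphism (fun x : yext s Y X => yrprod x u).
Proof. by move=> x y; rewrite /yrprod yprod_zmodl xcast_zmod. Qed.

Lemma yrprod0r s X Y B (x : yext s Y X) : yrprod x (0 : yext 0 B Y) = 0.
Proof. by rewrite /yrprod yprod0r -(subrr 0) xcast_zmod subrr. Qed.

Lemma yprod_prod0 s X Y B (x : yext s Y X) (u : yext 0 B Y) :
  yprod x u = xcast (esym (congr1 S (addn0 s))) (yrprod x u).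
Proof. by rewrite /yrprod xcastK. Qed.

Lemma yprodA s t X Y L B (x : yext s Y X) (e : yext 0 L Y)
    (u : yext t B L) :
  yprod x (yprod e u) =
  xcast (congr1 S (esym (addnS s t))) (yprod (yrprod x e) u).
Proof.
elim/ycls_ind: x => E; elim/ycls_ind: e => F; elim/ycls_ind: u => R.
rewrite yprod_cls [yprod (ycls E) _]yprod_cls yrprod_cls yprod_cls xcast_cls.
congr ycls; exact: yseq_prodS.
Qed.

End Product.

(** * Long exact sequences of Yoneda Ext in both variables *)

Section Exactness.
Variables (A : abelian) (C : exact_sub A).
Implicit Types X Y B K L U W : C.

Lemma ypushDr t B X X' (f : hom X X') (x y : yext t B X) :
  ypush f (x + y) = ypush f x + ypush f y.
Proof. exact: ypushD. Qed.

Lemma ypullDr t B B' X (g : hom B' B) (x y : yext t B X) :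
  ypull g (x + y) = ypull g x + ypull g y.
Proof. exact: ypullD. Qed.

Lemma ypush_0f t B X X' (x : yext t B X) : ypush (0 : hom X X') x = 0.
Proof. exact: ypush0. Qed.

Lemma ypull_0f t B B' X (x : yext t B X) : ypull (0 : hom B' B) x = 0.
Proof. exact: (@ext_pull0 _ _ t.+1). Qed.

Lemma ypush_eq0 t B X X' (f : hom X X') : ypush f (0 : yext t B X) = 0.
Proof. by apply: (addrI (ypush f 0)); rewrite -ypushDr !addr0. Qed.

Lemma ypull_eq0 t B B' X (g : hom B' B) : ypull g (0 : yext t B X) = 0.
Proof. exact: (@ext_pull_eq0 _ _ t.+1). Qed.

Lemma ypushN t B X X' (f : hom X X') (x : yext t B X) :
  ypush (- f) x = - ypush f x.
Proof.
apply/eqP; rewrite -addr_eq0 -[_ + _]/(yadd _ _) -ypush_add addNr.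
by rewrite ypush_0f.
Qed.

Lemma ypullN t B B' X (g : hom B' B) (x : yext t B X) :
  ypull (- g) x = - ypull g x.
Proof.
apply/eqP; rewrite -addr_eq0 -[_ + _]/(yadd _ _) -ypull_add addNr.
by rewrite ypull_0f.
Qed.

Lemma infl_mono B X (E : conflation B X) : is_mono (infl E).
Proof. by move=> T; exact: (is_kernel_mono (conflP E).1 (T := sval T)). Qed.

Lemma defl_epi B X (E : conflation B X) : is_epi (defl E).
Proof. by move=> T; exact: (is_cokernel_epi (conflP E).2 (T := sval T)). Qed.

Lemma infl_lift B X (E : conflation B X) T (t : hom T (mid E)) :
  defl E \c t = 0 -> exists s : hom T X, infl E \c s = t.
Proof.
by move=> /((conflP E).1.2 (sval T) t)[s [es _]]; exists s.
Qed.

Lemma defl_factor B X (E : conflation B X) T (t : hom (mid E) T) :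
  t \c infl E = 0 -> exists s : hom B T, s \c defl E = t.
Proof.
by move=> /((conflP E).2.2 (sval T) t)[s [es _]]; exists s.
Qed.

Lemma section_retraction B X (E : conflation B X) :
  (exists s : hom B (mid E), defl E \c s = idm B) <->
  (exists r : hom (mid E) X, r \c infl E = idm X).
Proof.
split=> [[s es]|[r er]].
  have [|r er] := infl_lift (E := E) (t := idm (mid E) - s \c defl E).
    by rewrite compmD compmN compA es comp1m compm1 subrr.
  exists r; apply: (infl_mono (E := E)).
  by rewrite compA er compDm compNm -compA defl_infl compm0 subr0 comp1m compm1.
have [|s es] := defl_factor (E := E) (t := idm (mid E) - infl E \c r).
  by rewrite compDm compNm -compA er comp1m compm1 subrr.
exists s; apply: (defl_epi (E := E)).
by rewrite -compA es compmD compmN compA defl_infl comp0m subr0 comp1m compm1.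
Qed.

(** By propositional extensionality [Q] is a function into [Prop] that is constant on Yoneda
    classes. *)
Lemma ycls_invariant t B X (Q : yseq t B X -> Prop) (E E' : yseq t B X) :
  (forall G G', yseq_mor G G' (idm X) (idm B) -> Q G <-> Q G') ->
  ycls E = ycls E' -> Q E -> Q E'.
Proof.
move=> inv e; have H := @ycls_compat A C Prop t B X Q.
rewrite -(H _ E) -?(H _ E') ?e //.
all: by move=> G G' /inv h; apply/propext.
Qed.

Notation ycls0 := (@ycls A C 0 _ _).

(** Having a section is invariant under morphisms with identity ends: sections are carried forward
    by composition and backward by the pull-back property. The split conflation has one. *)
Lemma ycls0_eq0_section B X (E : conflation B X) :
  ycls0 E = 0 -> exists s : hom B (mid E), defl E \c s = idm B.
Proof.
move=> /esym e.
pose Q (G : yseq 0 B X) := exists s : hom B (mid G), defl G \c s = idm B.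
apply: (ycls_invariant (Q := Q)) e _; last first.
  by exists (in2 (bip X B)); rewrite /= bipE.
move=> G G' [h [h1 h2]].
rewrite compm1 in h1; split=> [] [s es].
  by exists (h \c s); rewrite compA h2 comp1m.
have [_ pb] := ses_mor_pullback (abelianP A) (conflP G) (conflP G') h1 h2.
have [w [[_ ew] _]] := pb (sval B) s (idm B)
  (etrans es (esym (comp1m (idm B)))).
by exists w.
Qed.

Lemma ycls0_eq0_retraction B X (E : conflation B X) :
  ycls0 E = 0 -> exists r : hom (mid E) X, r \c infl E = idm X.
Proof. by move=> /ycls0_eq0_section/section_retraction. Qed.

Lemma ypull_defl B X (E : conflation B X) : ypull (defl E) (ycls0 E) = 0.
Proof.
rewrite -[RHS]ypush1; apply/esym/ycls_mor.
exists (infl E \c pr1 (bip X (mid E)) + pr2 (bip X (mid E))).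
rewrite /= compDm compmD !compA -!compA !bipE; split=> //.
by rewrite compA defl_infl comp0m add0r.
Qed.

Lemma ypush_infl B X (E : conflation B X) : ypush (infl E) (ycls0 E) = 0.
Proof.
rewrite -[RHS]ypull1; apply: ycls_mor.
exists (in1 (bip (mid E) B) + in2 (bip (mid E) B) \c defl E).
rewrite /= compDm compmD -!compA !bipE; split=> //.
by rewrite defl_infl !bipE.
Qed.

(** The middle term of [E] is an extension [G], by [U], of that of the push-out [E']. If [E']
    splits, pulling [G] back along the section yields the extension of [K] by [U]. *)
Lemma ypush0_exact B' U (F : conflation B' U) K (x : yext 0 K (mid F)) :
  ypush (defl F) x = 0 -> exists q, x = ypush (infl F) q.
Proof.
elim/ycls_ind: x => E; rewrite /= in E *.
have [E' [h [po he]]] := conf_push_ex (defl F) E.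
have -> : ypush (defl F) (ycls0 E) = ycls0 E'.
  rewrite -[RHS]ypull1; apply: ycls_mor; exists h.
  by rewrite comp1m he; split=> //; case: po.
move=> /ycls0_eq0_section[s es].
have sG := ses_pushout_epi (abelianP A) (conflP F) (conflP E) po.
pose G := @Conflation A C (mid E') U (mid E) (infl E \c infl F) h sG.
have [r [r1 r2]] := conf_pull_mor s G.
exists (ycls0 (conf_pull s G)); rewrite -[LHS]ypull1.
apply/esym/ycls_mor; exists r; split; first by rewrite r1 compm1.
by rewrite -he -compA [h \c r]r2 compA es.
Qed.

Lemma ypull0_exact B Y (F : conflation B Y) X (x : yext 0 (mid F) X) :
  ypull (infl F) x = 0 -> exists q, x = ypull (defl F) q.
Proof.
elim/ycls_ind: x => E; rewrite /= in E *.
have [E' [h [pb he]]] := conf_pull_ex (infl F) E.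
have -> : ypull (infl F) (ycls0 E) = ycls0 E'.
  rewrite -[RHS]ypush1; apply/esym/ycls_mor; exists h.
  by rewrite compm1 he; split=> //; case: pb.
move=> /ycls0_eq0_retraction[r er].
have sG := ses_pullback_mono (abelianP A) (conflP F) (conflP E) pb.
pose G := @Conflation A C B (mid E') (mid E) h (defl F \c defl E) sG.
have [m [m1 m2]] := conf_push_mor r G.
exists (ycls0 (conf_push r G)); rewrite -[LHS]ypush1.
apply: ycls_mor; exists m; split; last by rewrite m2 comp1m.
by rewrite -he compA [m \c h]m1 -compA er.
Qed.

(** A retraction of the push-out extends [infl E] to a map from the middle term of [G] to that of
    [E]; the map induced on quotients is [g]. *)
Lemma ypush_infl0_exact B X (E : conflation B X) M (y : yext 0 M X) :
  ypush (infl E) y = 0 -> exists g : hom M B, y = ypull g (ycls0 E).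
Proof.
elim/ycls_ind: y => G; rewrite /= in G *.
rewrite (@ypush_cls _ _ 0) => /ycls0_eq0_retraction[r er].
have [h [h1 _]] := conf_push_mor (infl E) G.
have [|g eg] := defl_factor (E := G) (t := defl E \c (r \c h)).
  by rewrite -!compA h1 [r \c _]compA er comp1m defl_infl.
exists g; rewrite -[LHS]ypush1; apply: ycls_mor.
exists (r \c h); split; last by rewrite eg.
by rewrite -compA h1 compA er comp1m compm1.
Qed.

Lemma ypull_defl0_exact B Y (F : conflation B Y) X (y : yext 0 B X) :
  ypull (defl F) y = 0 -> exists g : hom Y X, y = ypush g (ycls0 F).
Proof.
elim/ycls_ind: y => G; rewrite /= in G *.
rewrite (@ypull_cls _ _ 0) => /ycls0_eq0_section[s es].
have [h [_ h2]] := conf_pull_mor (defl F) G.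
have [|g eg] := infl_lift (E := G) (t := h \c s \c infl F).
  by rewrite !compA h2 -(compA (defl F)) es compm1 defl_infl.
exists g; rewrite -[LHS]ypull1; apply/esym/ycls_mor.
exists (h \c s); split; first by rewrite eg.
by rewrite compA h2 -compA es compm1 comp1m.
Qed.

(** Exactness is phrased as predicates of the degree because the induction alternates: exactness at
    the middle term for [t] gives it at the connecting map for [t], and this gives the middle term
    for [t.+1]. *)
Definition ypush_mid_exact t := forall B X (E : conflation B X) M
  (x : yext t M (mid E)),
  ypush (defl E) x = 0 -> exists q, x = ypush (infl E) q.

Definition yprod_conf_exact t := forall B X (E : conflation B X) M
  (x : yext t M B),
  yprod (ycls0 E) x = 0 -> exists p, x = ypush (defl E) p.

Definition ypull_mid_exact t := forall B Y (F : conflation B Y) X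
  (x : yext t (mid F) X),
  ypull (infl F) x = 0 -> exists q, x = ypull (defl F) q.

Definition yrprod_conf_exact t := forall B Y (F : conflation B Y) X
  (x : yext t Y X),
  yrprod x (ycls0 F) = 0 -> exists p, x = ypull (infl F) p.

(* The conclusion is a property [Q] of the splice of E and x.  Exactness at the
   middle of a Mayer-Vietoris sequence makes [Q] invariant under the morphisms
   generating the Yoneda equivalence. *)
Lemma ypush_mid_exact_yprod t : ypush_mid_exact t -> yprod_conf_exact t.
Proof.
move=> exc B X E M x; elim/ycls_ind: x => R; rewrite yprod_cls => /esym e.
pose Q (G : yseq t.+1 M X) := exists p,
  ycls (projT2 G).2 = ypush (defl (projT2 G).1) p.
apply: (ycls_invariant (Q := Q)) e _; last first.
  by exists 0; rewrite ypush_eq0.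
move=> [K [F S]] [K' [F' S']] [k [[h [h1 h2]] kS]]; rewrite /Q /=.
rewrite /= in k h h1 h2 kS; rewrite compm1 in h1.
have ekS : ypush k (ycls S) = ycls S' by rewrite -[RHS]ypull1; exact: ycls_mor.
split=> [[p ep]|[p' ep']].
  by exists (ypush h p); rewrite -ekS ep -!ypushM h2.
pose b := bip K (mid F').
have sW := ses_mayer_vietoris (abelianP A) (bip_sub b) (conflP F) (conflP F')
  h1 h2.
pose W := @Conflation A C K' (mid F) b _ _ sW.
have [|q eq] := exc _ _ W _ (ypush (in1 b) (ycls S) + ypush (in2 b) p').
  rewrite ypushDr -!ypushM.
  have -> : defl W \c in1 b = k.
    by rewrite [defl W]/(k \c pr1 b - defl F' \c pr2 b) compDm compNm -!compA
      !bipE oppr0 addr0.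
  have -> : defl W \c in2 b = - defl F'.
    by rewrite [defl W]/(k \c pr1 b - defl F' \c pr2 b) compDm compNm -!compA
      !bipE.
  by rewrite ekS ep' ypushN subrr.
exists q; have := congr1 (ypush (pr1 b)) eq.
rewrite ypushDr -!ypushM !bipE ypush1 ypush_0f addr0 => ->.
congr (ypush _ q).
by rewrite [infl W]/(in1 b \c defl F + in2 b \c h) compmD !bipE.
Qed.

(** Dual to [ypush_mid_exact_yprod]. The last conflation is not a component of a [yseq], so [Q]
    quantifies over decompositions by [yseq_rcons]; [inv], applied to identity morphisms, shows that
    the choice of decomposition is immaterial. *)
Lemma ypull_mid_exact_yrprod t : ypull_mid_exact t -> yrprod_conf_exact t.
Proof.
move=> exc B Y E X x; elim/ycls_ind: x => R; rewrite yrprod_cls => e0.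
have e1 : ycls (yseq_rcons (yseq_split t (zob C) X) (conf_split B (zob C)))
    = 0 by rewrite -yrprod_cls; exact: yrprod0r.
have e := etrans e1 (esym e0).
pose P K (S : yseq t K X) (F : conflation B K) :=
  exists p, ycls S = ypull (infl F) p.
have inv K (S : yseq t K X) (F : conflation B K) K' (S' : yseq t K' X)
    (F' : conflation B K') :
  yseq_mor (yseq_rcons S F) (yseq_rcons S' F') (idm X) (idm B) ->
  P K S F <-> P K' S' F'.
  case/yseq_rcons_mor=> k [kS [h [h1 h2]]]; rewrite comp1m in h2.
  have ekS : ypull k (ycls S') = ycls S.
    by rewrite -[RHS]ypush1; exact/esym/ycls_mor.
  split=> [[p ep]|[p' ep']]; last first.
    by exists (ypull h p'); rewrite -ekS ep' -!ypullM h1.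
  pose b := bip K' (mid F).
  have sW := ses_mayer_vietoris_dual (abelianP A) (bip_sub b) (conflP F)
    (conflP F') h1 h2.
  pose W := @Conflation A C (mid F') K b _ _ sW.
  have [|q eq] := exc _ _ W _ (ypull (pr1 b) (ycls S') + ypull (pr2 b) p).
    rewrite ypullDr -!ypullM.
    have -> : pr1 b \c infl W = k.
      by rewrite [infl W]/(in1 b \c k - in2 b \c infl F) compmD compmN
        !bipE oppr0 addr0.
    have -> : pr2 b \c infl W = - infl F.
      by rewrite [infl W]/(in1 b \c k - in2 b \c infl F) compmD compmN
        !bipE.
    by rewrite ekS ep ypullN subrr.
  exists q; have := congr1 (ypull (in1 b)) eq.
  rewrite ypullDr -!ypullM !bipE ypull1 ypull_0f addr0 => ->.
  congr (ypull _ q).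
  by rewrite [defl W]/(infl F' \c pr1 b + h \c pr2 b) compDm -!compA !bipE.
pose Q (G : yseq t.+1 B X) := exists K (S : yseq t K X) (F : conflation B K),
  G = yseq_rcons S F /\ P K S F.
have invQ G G' : yseq_mor G G' (idm X) (idm B) -> Q G <-> Q G'.
  move=> m; have [K [S [F eG]]] := yseq_rcons_inv G.
  have [K' [S' [F' eG']]] := yseq_rcons_inv G'.
  rewrite eG eG' in m *; split=> [] [L [T [H [eTH pTH]]]].
    exists K', S', F'; split=> //; apply: (inv _ _ _ _ _ _ m).1.
    by apply: (inv _ _ _ _ _ _ _).2 pTH; rewrite eTH; exact: yseq_mor_id.
  exists K, S, F; split=> //; apply: (inv _ _ _ _ _ _ m).2.
  by apply: (inv _ _ _ _ _ _ _).2 pTH; rewrite eTH; exact: yseq_mor_id.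
have [|K [S [F [eSF pSF]]]] := ycls_invariant invQ e.
  exists (zob C), (yseq_split t (zob C) X), (conf_split B (zob C)); split=> //.
  by exists 0; rewrite ypull_eq0.
by apply: (inv _ _ _ _ _ _ _).2 pSF; rewrite -eSF; exact: yseq_mor_id.
Qed.

(** For [x] the splice of [E] and [R], exactness at the connecting map of the push-out [E'] writes
    [R] as a push-out along [defl E']. Moving [defl E'] across to [E] makes the degree-one case
    applicable there. *)
Lemma ypush_exact t : ypush_mid_exact t.
Proof.
elim: t => [|t IH] B X F M x; first exact: ypush0_exact.
elim/ycls_ind: x => -[K [E R]] e0.
rewrite ycls_splice in e0 *.
pose E' := conf_push (defl F) E.
have eE : ypush (defl F) (ycls0 E) = ycls0 E' by rewrite (@ypush_cls _ _ 0).
have [|p ep] := ypush_mid_exact_yprod IH (E := E') (x := ycls R).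
  by rewrite -eE yprod_push.
have [|q eq] := ypush0_exact (F := F) (x := ypull (defl E') (ycls0 E)).
  by rewrite ypush_pull eE ypull_defl.
by exists (yprod q p); rewrite ep -yprod_mid eq yprod_push.
Qed.

Lemma yprod_conf_ker t : yprod_conf_exact t.
Proof. exact/ypush_mid_exact_yprod/ypush_exact. Qed.

Lemma ypull_exact t : ypull_mid_exact t.
Proof.
elim: t => [|t IH] B Y F X x; first exact: ypull0_exact.
elim/ycls_ind: x => G; have [K [R [E ->]]] := yseq_rcons_inv G.
rewrite -yrprod_cls => e0.
pose E' := conf_pull (infl F) E.
have eE : ypull (infl F) (ycls0 E) = ycls0 E' by rewrite (@ypull_cls _ _ 0).
have [|p ep] := ypull_mid_exact_yrprod IH (F := E') (x := ycls R).
  by rewrite -eE yrprod_pull.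
have [|q eq] := ypull0_exact (F := F) (x := ypush (infl E') (ycls0 E)).
  by rewrite -ypush_pull eE ypush_infl.
by exists (yrprod p q); rewrite ep yrprod_mid eq yrprod_pull.
Qed.

Lemma yrprod_conf_ker t : yrprod_conf_exact t.
Proof. exact/ypull_mid_exact_yrprod/ypull_exact. Qed.

(** As in [ypush_exact], the problem moves to the first conflation [G]; there the degree-one case
    gives a pull-back of [E] along [g], and [g] moves back across the splice. *)
Lemma yprod_conf_im t B X (E : conflation B X) M (y : yext t.+1 M X) :
  ypush (infl E) y = 0 -> exists x, y = yprod (ycls0 E) x.
Proof.
elim/ycls_ind: y => -[K [G R]] e0.
rewrite ycls_splice in e0 *.
pose G' := conf_push (infl E) G.
have eG : ypush (infl E) (ycls0 G) = ycls0 G' by rewrite (@ypush_cls _ _ 0).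
have [|p ep] := @yprod_conf_ker _ _ _ G' _ (ycls R).
  by rewrite -eG yprod_push.
have [|g eg] := ypush_infl0_exact (E := E) (y := ypull (defl G') (ycls0 G)).
  by rewrite ypush_pull eG ypull_defl.
by exists (ypush g p); rewrite ep -!yprod_mid eg.
Qed.

Lemma yrprod_conf_im t B Y (F : conflation B Y) X (y : yext t.+1 B X) :
  ypull (defl F) y = 0 -> exists x, y = yrprod x (ycls0 F).
Proof.
elim/ycls_ind: y => H; have [K [R [G ->]]] := yseq_rcons_inv H.
rewrite -yrprod_cls => e0.
pose G' := conf_pull (defl F) G.
have eG : ypull (defl F) (ycls0 G) = ycls0 G' by rewrite (@ypull_cls _ _ 0).
have [|p ep] := @yrprod_conf_ker _ _ _ G' _ (ycls R).
  by rewrite -eG yrprod_pull.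
have [|g eg] := ypull_defl0_exact (F := F) (y := ypush (infl G') (ycls0 G)).
  by rewrite -ypush_pull eG ypush_infl.
by exists (ypull g p); rewrite ep !yrprod_mid eg.
Qed.

End Exactness.

(** * Isomorphisms of abelian groups *)

Lemma inj_surj_bijective (U V : Type) (f : U -> V) :
  injective f -> (forall y, exists x, y = f x) -> bijective f.
Proof.
move=> fI fS; pose g y := projT1 (cid (fS y)).
have gK : cancel g f by move=> y; rewrite /g; case: cid.
by exists g => // x; apply: fI; rewrite gK.
Qed.

Lemma zmod_inj (U V : zmodType) (f : U -> V) :
  zmod_morphism f -> (forall x, f x = 0 -> x = 0) -> injective f.
Proof.
by move=> fB f0 x y e; apply/subr0_eq/f0; rewrite fB e subrr.
Qed.

Lemma bijective_group_iso (U V : zmodType) (f : U -> V) :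
  zmod_morphism f -> bijective f -> group_iso U V.
Proof.
move=> fB fbij.
pose F : {additive U -> V} :=
  HB.pack f (GRing.isZmodMorphism.Build U V f fB).
by exists F.
Qed.

Lemma group_iso_sym (U V : zmodType) : group_iso U V -> group_iso V U.
Proof.
case=> f [g gK fK]; apply: (@bijective_group_iso _ _ g); last by exists f.
by move=> x y; apply: (can_inj gK); rewrite raddfB !fK.
Qed.

Lemma group_iso_trans (U V W : zmodType) :
  group_iso U V -> group_iso V W -> group_iso U W.
Proof.
move=> [f fbij] [g gbij]; apply: (@bijective_group_iso _ _ (g \o f)).
  by move=> x y; rewrite /= !raddfB.
exact: bij_comp.
Qed.

Lemma quot_group_iso (U V : zmodType) (S : zmodClosed U) (f : U -> V) :
  zmod_morphism f -> (forall y, exists x, y = f x) ->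
  (forall x, f x = 0 <-> x \in S) -> group_iso (Quotient.quot S) V.
Proof.
move=> fB fS f0.
have fE x y : \pi_(Quotient.quot S) x = \pi_(Quotient.quot S) y <-> f x = f y.
  split=> [/eqP|e].
    by rewrite -Quotient.idealrBE => /f0; rewrite fB => /subr0_eq.
  by apply/eqP; rewrite -Quotient.idealrBE; apply/f0; rewrite fB e subrr.
have fK x : f (repr (\pi_(Quotient.quot S) x)) = f x by apply/fE/reprK.
apply: (@bijective_group_iso _ _ (fun q => f (repr q))).
  elim/quotW => x; elim/quotW => y.
  by rewrite -pi_is_zmod_morphism !fK fB.
apply: inj_surj_bijective.
  by elim/quotW => x; elim/quotW => y; rewrite !fK => /fE.
by move=> y; have [x ->] := fS y; exists (\pi x); rewrite fK.
Qed.

(** * Dimension shifting, and covers by sequences with n-projective or n-injective middle terms *)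

Section Dimension_shifting.
Variables (A : abelian) (C : exact_sub A).
Implicit Types X Y B K L U W : C.
Notation ycls0 := (@ycls A C 0 _ _).

(** For one conflation, injectivity and surjectivity are obstructed by Ext into the middle term in
    degrees [s.+1] and [s.+2]. As [yext s] has degree [s.+1], the bound [n <= s] makes both vanish.
    Longer sequences compose such bijections. *)
Lemma yprod_bijr n t : forall B X (D : yseq t B X),
  yseq_mids (ninj n) D -> forall s M, (n <= s)%N ->
  bijective (fun u : yext s M B => yprod (ycls D) u).
Proof.
have base B X (E : conflation B X) s M : ninj n (mid E) -> (n <= s)%N ->
    bijective (fun u : yext s M B => yprod (ycls0 E) u : yext s.+1 M X).
  move=> iE ns; apply: inj_surj_bijective.
    apply: zmod_inj; first exact: (@yprod_zmodr A C 0 s X B M (ycls0 E)).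
    move=> u /yprod_conf_ker[p ->].
    by rewrite (iE s.+1 _ _ p) // ypush_eq0.
  by move=> y; apply: yprod_conf_im; apply: (iE s.+2); rewrite ltnS ltnW.
elim: t => [|t IH] B X D; first by move=> h s M; exact: base.
case: D => K [E R] [iE iR] s M ns.
have nts : (n <= (t + s).+1)%N := leqW (leq_trans ns (leq_addl _ _)).
have b := bij_comp (base _ _ E (t + s).+1 M iE nts)
  (IH _ _ R iR s M ns).
apply: (@eq_bij (yext (t.+1 + s).+1 M X) (yext s M B) _ b) => u.
by elim/ycls_ind: u => G; rewrite /= !yprod_cls.
Qed.

Lemma yprod_bijl n t : forall B Y (D : yseq t B Y),
  yseq_mids (nproj n) D -> forall s X, (n <= s)%N ->
  bijective (fun x : yext s Y X => yprod x (ycls D)).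
Proof.
have castbij s t' (e : s = t') B X : bijective (@xcast _ C s t' e B X).
  by exists (@xcast A C _ _ (esym e) B X); [exact: xcastK | exact: xcastKV].
have base B Y (E : conflation B Y) s X : nproj n (mid E) -> (n <= s)%N ->
    bijective (fun x : yext s Y X => yrprod x (ycls0 E)).
  move=> pE ns; apply: inj_surj_bijective.
    apply: zmod_inj; first exact: yrprod_zmod.
    move=> x /yrprod_conf_ker[p ->].
    by rewrite (pE s.+1 _ _ p) // ypull_eq0.
  by move=> y; apply: yrprod_conf_im; apply: (pE s.+2); rewrite ltnS ltnW.
elim: t => [|t IH] B Y D.
  move=> pD s X ns.
  have b := bij_comp (castbij _ _ (esym (congr1 S (addn0 s))) B X)
    (base _ _ D s X pD ns).
  apply: (@eq_bij (yext (s + 0).+1 B X) (yext s Y X) _ b) => x.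
  exact/esym/yprod_prod0.
case: D => K [E R] [pE pR] s X ns.
have b := bij_comp (castbij _ _ (congr1 S (esym (addnS s t))) B X)
  (bij_comp (IH _ _ R pR s.+1 X (leqW ns)) (base _ _ E s X pE ns)).
apply: (@eq_bij (yext (s + t.+1).+1 B X) (yext s Y X) _ b) => x.
by rewrite /= ycls_splice yprodA.
Qed.

(** The n-projective covers the middle term of [F]; composing with [defl F] gives the new deflation,
    whose kernel is the pull-back of the cover along [infl F]. *)
Lemma conf_cover n B X (F : conflation B X) : enough_nproj C n ->
  exists X' (G : conflation B X') (f : hom X' X),
    nproj n (mid G) /\ conf_mor G F f (idm B).
Proof.
move=> /(_ (mid F))[K [G0 pG0]].
have [G1 [h [pb _]]] := conf_pull_ex (infl F) G0.
have s := ses_pullback_mono (abelianP A) (conflP F) (conflP G0) pb.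
exists (mid G1), (@Conflation A C B _ (mid G0) h (defl F \c defl G0) s).
exists (defl G1); split=> //; exists (defl G0).
by rewrite comp1m; split=> //; case: pb.
Qed.

Lemma conf_cocover n B X (F : conflation B X) : enough_ninj C n ->
  exists B' (G : conflation B' X) (g : hom B B'),
    ninj n (mid G) /\ conf_mor F G (idm X) g.
Proof.
move=> /(_ (mid F))[K [G0 iG0]].
have [G1 [h [po _]]] := conf_push_ex (defl F) G0.
have s := ses_pushout_epi (abelianP A) (conflP F) (conflP G0) po.
exists (mid G1), (@Conflation A C _ X (mid G0) (infl G0 \c infl F) h s).
exists (infl G1); split=> //; exists (infl G0).
by rewrite compm1; split=> //; case: po.
Qed.

(** The cover is built from the end [B]: each conflation is pulled back along the map [l] already
    constructed, and then covered. *)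
Lemma nproj_yseq_cover n t : enough_nproj C n -> forall B X (E : yseq t B X),
  exists X' (D : yseq t B X') (f : hom X' X),
    yseq_mids (nproj n) D /\ yseq_mor D E f (idm B).
Proof.
move=> en; elim: t => [|t IH] B X E; first exact: conf_cover.
case: E => K [E R]; have [L [D [l [pD mD]]]] := IH _ _ R.
have [X' [G [f [pG mG]]]] := conf_cover (conf_pull l E) en.
exists X', (ysplice G D), f; split=> //; exists l; split=> //=.
by have := conf_mor_comp mG (conf_pull_mor l E); rewrite comp1m compm1.
Qed.

Lemma ninj_yseq_cocover n t : enough_ninj C n -> forall B X (E : yseq t B X),
  exists B' (D : yseq t B' X) (g : hom B B'),
    yseq_mids (ninj n) D /\ yseq_mor E D (idm X) g.
Proof.
move=> en B X E.
(* The cocover is built from the start [X], so the induction must allow a map [f] carried over from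
   the preceding conflation. *)
suff: forall Z (f : hom X Z), exists B' (D : yseq t B' Z) (g : hom B B'),
    yseq_mids (ninj n) D /\ yseq_mor E D f g by apply.
elim: t B X E => [|t IH] B X E Z f.
  have [B' [G [g [iG mG]]]] := conf_cocover (conf_push f E) en.
  exists B', G, g; split=> //.
  by have := conf_mor_comp (conf_push_mor f E) mG; rewrite comp1m compm1.
case: E => K [E R].
have [L [G [l [iG mG]]]] := conf_cocover (conf_push f E) en.
have [B' [D [g [iD mD]]]] := IH _ _ R L l.
exists B', (ysplice G D), g; split=> //; exists l; split=> //=.
by have := conf_mor_comp (conf_push_mor f E) mG; rewrite comp1m compm1.
Qed.

Lemma yext_nproj_push n t B X (x : yext t B X) : enough_nproj C n ->
  exists X' (D : yseq t B X') (f : hom X' X),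
    yseq_mids (nproj n) D /\ x = ypush f (ycls D).
Proof.
elim/ycls_ind: x => E en; have [X' [D [f [pD m]]]] := nproj_yseq_cover en E.
by exists X', D, f; rewrite (ycls_mor m) ypull1.
Qed.

Lemma yext_ninj_pull n t B X (x : yext t B X) : enough_ninj C n ->
  exists B' (D : yseq t B' X) (g : hom B B'),
    yseq_mids (ninj n) D /\ x = ypull g (ycls D).
Proof.
elim/ycls_ind: x => E en; have [B' [D [g [iD m]]]] := ninj_yseq_cocover en E.
by exists B', D, g; rewrite -(ycls_mor m) ypush1.
Qed.

End Dimension_shifting.

(** * Natural transformations over an n-Frobenius category *)

Section Frobenius.
Variables (A : abelian) (C : exact_sub A) (n : nat).
Hypothesis frobC : nFrobenius C n.
Implicit Types X Y B K L U W M N S Z : C.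
Notation ycls0 := (@ycls A C 0 _ _).

Lemma frobenius_mids t B X (D : yseq t B X) :
  yseq_mids (nproj n) D <-> yseq_mids (ninj n) D.
Proof.
have [_ _ pi] := frobC.
elim: t B X D => [|t IH] B X; first by move=> D; exact: pi.
by case=> K [E R]; split=> [] [/pi pE /IH pR].
Qed.

Lemma yprod_inv k s S M X (e : yseq k S M) :
  yseq_mids (nproj n) e -> (n <= s)%N ->
  {r : yext (s + k).+1 S X -> yext s M X |
    cancel (fun x => yprod x (ycls e)) r /\
    cancel r (fun x => yprod x (ycls e))}.
Proof.
by move=> pe ns; apply: cid; have [r] := yprod_bijl pe X ns; exists r.
Qed.

(** Splicing on this side needs n-injective middle terms, which the coincidence of the two classes
    provides. *)
Lemma yprod_invr k s N Z X (d : yseq k N Z) :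
  yseq_mids (nproj n) d -> (n <= s)%N ->
  {l : yext (k + s).+1 X Z -> yext s X N |
    cancel (fun x => yprod (ycls d) x) l /\
    cancel l (fun x => yprod (ycls d) x)}.
Proof.
move=> /frobenius_mids iD ns; apply: cid.
by have [l] := yprod_bijr iD X ns; exists l.
Qed.

Section NatExt.
Variables (k : nat) (N Z S M : C) (d : yseq k N Z) (e : yseq k S M).
Hypotheses (le_nk : (n <= k)%N) (pd : yseq_mids (nproj n) d)
  (pe : yseq_mids (nproj n) e).

Let r X := sval (yprod_inv X pe le_nk).
Let l X := sval (yprod_invr X pd le_nk).

Let rK X : cancel (fun x => yprod x (ycls e)) (@r X).
Proof. exact: (svalP (yprod_inv X pe le_nk)).1. Qed.
Let Kr X : cancel (@r X) (fun x => yprod x (ycls e)).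
Proof. exact: (svalP (yprod_inv X pe le_nk)).2. Qed.
Let lK X : cancel (fun x => yprod (ycls d) x) (@l X).
Proof. exact: (svalP (yprod_invr X pd le_nk)).1. Qed.
Let Kl X : cancel (@l X) (fun x => yprod (ycls d) x).
Proof. exact: (svalP (yprod_invr X pd le_nk)).2. Qed.

Lemma yext_shift_iso : group_iso (yext k M Z) (yext k S N).
Proof.
apply: (@bijective_group_iso _ _ (fun v => l (yprod v (ycls e)))).
  by move=> v w; apply: (can_inj (@lK S)); rewrite yprod_zmodr !Kl yprod_zmodl.
by exists (fun u => r (yprod (ycls d) u)) => u; rewrite ?Kl ?rK ?Kr ?lK.
Qed.

Fact Nat_cov_zmod (u : yext k S N) X :
  zmod_morphism (fun x : yext k N X => r (yprod x u)).
Proof.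
by move=> x y; apply: (can_inj (@rK X)); rewrite Kr !yprod_zmodl !Kr.
Qed.

Fact Nat_cov_natural (u : yext k S N) X Y (f : hom X Y)
    (x : Ext_cov k.+1 N X) :
  r (yprod (fmap f x : yext k N Y) u) =
  fmap f (r (yprod x u) : Ext_cov k.+1 M X).
Proof.
apply: (can_inj (@rK Y)); rewrite Kr.
change (yprod (ypush f (x : yext k N X)) u =
  yprod (ypush f (r (yprod x u))) (ycls e)).
by rewrite !yprod_push Kr.
Qed.

Definition Nat_cov (u : yext k S N) :
    Nat (Ext_cov k.+1 N) (Ext_cov k.+1 M) :=
  @NatTrans C (Ext_cov k.+1 N) (Ext_cov k.+1 M) (fun X x => r (yprod x u))
    (Nat_cov_zmod u) (Nat_cov_natural u).

Lemma Nat_cov_iso :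
  group_iso (yext k S N) (Nat (Ext_cov k.+1 N) (Ext_cov k.+1 M)).
Proof.
have Nat_covB : zmod_morphism Nat_cov.
  move=> u v; apply: nattrans_eq => X x; apply: (can_inj (@rK X)).
  change (yprod (r (yprod x (u - v))) (ycls e) =
    yprod (r (yprod x u) - r (yprod x v)) (ycls e)).
  by rewrite yprod_zmodl !Kr yprod_zmodr.
apply: (bijective_group_iso Nat_covB); apply: inj_surj_bijective.
  apply: (zmod_inj Nat_covB) => u u0.
  (* The transformation given by [u] is evaluated at the class of [d]; the value determines [u] by
     dimension shifting. *)
  have du0 : r (yprod (ycls d) u) = 0.
    exact: (congr1 (fun p : nattrans (Ext_cov k.+1 N) (Ext_cov k.+1 M) =>
      p Z (ycls d)) u0).
  by apply: (can_inj (@lK S)); rewrite yprod0r -[LHS]Kr du0 yprod0l.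
(* Evaluation at the class of [d] leaves this as the only candidate. *)
move=> p; pose u := l (yprod (p Z (ycls d) : yext k M Z) (ycls e)).
exists u; apply: nattrans_eq => X x.
suff: yprod (p X x : yext k M X) (ycls e) = yprod (x : yext k N X) u.
  by move=> ep; apply: (can_inj (@rK X)); rewrite /= Kr.
have [en _ _] := frobC; pose b := bip X Z.
(* One n-projective sequence of which both [x] and [d] are push-outs. *)
have [Y [D [f [pD eD]]]] := yext_nproj_push
  (ypush (in1 b) x + ypush (in2 b) (ycls d)) en.
have ex : x = ypush (pr1 b \c f) (ycls D).
  by rewrite ypushM -eD ypushDr -!ypushM !bipE ypush1 ypush_0f addr0.
have ed : ycls d = ypush (pr2 b \c f) (ycls D).
  by rewrite ypushM -eD ypushDr -!ypushM !bipE ypush1 ypush_0f add0r.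
have [lD [_ KlD]] := yprod_invr S pD le_nk.
(* By naturality [v] represents [p] on all push-outs of [D]; since [d] is one of them, [v] equals
   [u]. *)
pose v := lD (yprod (p Y (ycls D) : yext k M Y) (ycls e)).
have nat_p W (g : hom Y W) : yprod (p W (ypush g (ycls D)) : yext k M W)
    (ycls e) = yprod (ypush g (ycls D)) v.
  by rewrite (nt_natural p g (ycls D)) !yprod_push KlD.
suff -> : u = v by rewrite ex nat_p.
by apply: (can_inj (@lK S)); rewrite Kl ed nat_p.
Qed.

Fact Nat_con_zmod (v : yext k M Z) X :
  zmod_morphism (fun x : yext k X M => l (yprod v x)).
Proof.
by move=> x y; apply: (can_inj (@lK X)); rewrite Kl !yprod_zmodr !Kl.
Qed.

Fact Nat_con_natural (v : yext k M Z) (X Y : opcat C) (f : hom X Y)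
    (x : Ext_con k.+1 M X) :
  l (yprod v (fmap f x : yext k (Y : C) M)) =
  fmap f (l (yprod v x) : Ext_con k.+1 N X).
Proof.
apply: (can_inj (@lK Y)); rewrite Kl.
change (yprod v (ypull f (x : yext k (X : C) M)) =
  yprod (ycls d) (ypull f (l (yprod v x)))).
by rewrite !yprod_pull Kl.
Qed.

Definition Nat_con (v : yext k M Z) :
    Nat (Ext_con k.+1 M) (Ext_con k.+1 N) :=
  @NatTrans (opcat C) (Ext_con k.+1 M) (Ext_con k.+1 N)
    (fun X x => l (yprod v x)) (Nat_con_zmod v) (Nat_con_natural v).

(** Dual to [Nat_cov_iso]: the test element is the class of [e], and [x] and [e] are pull-backs of a
    common sequence [D]. *)
Lemma Nat_con_iso :
  group_iso (yext k M Z) (Nat (Ext_con k.+1 M) (Ext_con k.+1 N)).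
Proof.
have Nat_conB : zmod_morphism Nat_con.
  move=> u v; apply: nattrans_eq => X x; apply: (can_inj (@lK X)).
  change (yprod (ycls d) (l (yprod (u - v) x)) =
    yprod (ycls d) (l (yprod u x) - l (yprod v x))).
  by rewrite yprod_zmodr !Kl yprod_zmodl.
apply: (bijective_group_iso Nat_conB); apply: inj_surj_bijective.
  apply: (zmod_inj Nat_conB) => v v0.
  have ve0 : l (yprod v (ycls e)) = 0.
    exact: (congr1 (fun p : nattrans (Ext_con k.+1 M) (Ext_con k.+1 N) =>
      p S (ycls e)) v0).
  by apply: (can_inj (@rK Z)); rewrite yprod0l -[LHS]Kl ve0 yprod0r.
move=> p; pose v := r (yprod (ycls d) (p S (ycls e) : yext k S N)).
exists v; apply: nattrans_eq => X x.
suff: yprod (ycls d) (p X x : yext k (X : C) N) =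
    yprod v (x : yext k (X : C) M).
  by move=> ep; apply: (can_inj (@lK X)); rewrite /= Kl.
have [_ en _] := frobC; pose b := @bip A C X S.
have [Y [D [f [/frobenius_mids pD eD]]]] := yext_ninj_pull
  (ypull (pr1 b) (x : yext k (X : C) M) + ypull (pr2 b) (ycls e)) en.
have ex : x = ypull (f \c in1 b) (ycls D).
  by rewrite ypullM -eD ypullDr -!ypullM !bipE ypull1 ypull_0f addr0.
have ee : ycls e = ypull (f \c in2 b) (ycls D).
  by rewrite ypullM -eD ypullDr -!ypullM !bipE ypull1 ypull_0f add0r.
have [rD [_ KrD]] := yprod_inv Z pD le_nk.
pose w := rD (yprod (ycls d) (p Y (ycls D) : yext k Y N)).
have nat_p W (g : @hom C W Y) : yprod (ycls d)
    (p W (ypull g (ycls D)) : yext k W N) = yprod w (ypull g (ycls D)).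
  by rewrite (nt_natural p (g : @hom (opcat C) Y W) (ycls D)) !yprod_pull KrD.
suff -> : v = w by rewrite ex nat_p.
by apply: (can_inj (@rK Z)); rewrite Kr ee nat_p.
Qed.

End NatExt.

(** * The quotient by push-outs from n-projectives *)

Lemma yprod_nproj_eq0 s P X M (x : yext 0 P X) (b : yext s M P) :
  nproj n P -> (n <= s.+1)%N -> yprod x b = 0 :> yext s.+1 M X.
Proof.
move=> pP ns; have [en _ _] := frobC.
(* Splicing with a syzygy sequence of [X] raises [x] to a vanishing degree. *)
have [Z [D [_ [/frobenius_mids iD _]]]] :=
  nproj_yseq_cover en (yseq_split n X (zob C)).
apply: (bij_inj (yprod_bijr iD M ns)); rewrite yprod0r yprodA.
(* Here [D] has length [n.+1] and [x] length 1, so their splice has degree [n.+2] with the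
   n-projective [P] as first argument. *)
rewrite (pP n.+2 _ _ (yrprod (ycls D) x)) ?ltnS ?leqnSn // yprod0l.
by rewrite -(subrr 0) xcast_zmod subrr.
Qed.

(** The connecting homomorphism of the long exact sequence of Ext from [M], with degree 0 separate
    because Ext is Hom there. *)
Definition conf_connect k M B X (E : conflation B X) (x : Ext k M B) :
    yext k M X :=
  (if k is k'.+1 return Ext k M B -> yext k M X
   then fun x => yprod (ycls0 E) (x : yext k' M B)
   else fun x => ypull x (ycls0 E)) x.

Lemma conf_connect_zmod k M B X (E : conflation B X) :
  zmod_morphism (@conf_connect k M B X E).
Proof.
case: k => [|k] x y; last exact: (@yprod_zmodr _ _ 0 k).
by rewrite /= ypull_add ypullN.
Qed.

Lemma Ext_mod_pushP_iso k M B X (E : conflation B X) :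
  (n <= k)%N -> nproj n (mid E) ->
  group_iso (Ext_mod_pushP n k M B) (yext k M X).
Proof.
move=> nk pE; have [_ _ pi] := frobC.
apply: (quot_group_iso (f := conf_connect E)).
- exact: conf_connect_zmod.
- move=> y.
  (* The obstruction to surjectivity lies in degree [k.+1] with values in the middle term of [E],
     which is n-injective as well. *)
  have yE : ypush (infl E) y = 0 by have /pi iE := pE; exact: (iE k.+1).
  case: k nk y yE => [|k] nk y yE; first exact: ypush_infl0_exact.
  exact: yprod_conf_im.
move=> x; split=> [x0|/asboolP[P [f [b [pP ->]]]]].
  apply/asboolP; exists (mid E), (defl E).
  suff [p ->] : exists p, x = ext_push (defl E) p by exists p.
  case: k nk x x0 => [|k] nk x x0; last exact: yprod_conf_ker.
  rewrite /conf_connect (@ypull_cls _ _ 0) in x0.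
  have [s es] := ycls0_eq0_section x0.
  have [h [_ h2]] := conf_pull_mor x E.
  by exists (h \c s); rewrite /= compA h2 -compA es compm1.
case: k nk b {x} => [|k] nk b.
  (* Now [k = 0] forces [n = 0], so the pull-back of [E] to [P] vanishes in degree 1. *)
  by rewrite /= ypullM (pP 1%N _ _ (ypull f (ycls0 E))) ?ypull_eq0.
rewrite /= -yprod_mid; exact: yprod_nproj_eq0.
Qed.

End Frobenius.

Theorem theorem1p2 (A : abelian) (C : exact_sub A) (n : nat)
    (frobC : nFrobenius C n) (M N : C) (k : nat) (le_nk : (n <= k)%N)
    (ON : C) (dN : Ext k N ON) (syzN : syzygy n dN) :
  group_iso (Ext_mod_pushP n k M ON)
            (Nat (Ext_cov k.+1 N) (Ext_cov k.+1 M)) /\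
  group_iso (Nat (Ext_cov k.+1 N) (Ext_cov k.+1 M))
            (Nat (Ext_con k.+1 M) (Ext_con k.+1 N)).
Proof.
have [enp eni _] := frobC.
have [Z [E pE]] := enp ON.
(* Splicing [E] onto the syzygy sequence gives length [k.+1], that is index [k]; for [k = 0] the
   sequence is [E] itself. *)
have [d pd] : exists d : yseq k N Z, yseq_mids (nproj n) d.
  by case: syzN E pE => [B|t B X D pD] E pE; [exists E | exists (ysplice E D)].
(* The split extension is a convenient input starting at [M]; its cocover supplies [e]. *)
have [S [e [_ [/(frobenius_mids frobC) pe _]]]] :=
  ninj_yseq_cocover eni (yseq_split k (zob C) M).
have quo := Ext_mod_pushP_iso frobC M le_nk pE.
have shift := yext_shift_iso frobC le_nk pd pe.
have cov := Nat_cov_iso frobC le_nk pd pe.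
have con := Nat_con_iso frobC le_nk pd pe.
split; first exact: group_iso_trans quo (group_iso_trans shift cov).
exact: group_iso_trans (group_iso_sym (group_iso_trans shift cov)) con.
Qed.
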